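(* Let $N$ be a positive integer and $\delta,\alpha$ real numbers with $\delta\le 1/8$ and $640N^{-1/2}<\alpha\le 2^{-27}\delta$. Let $\Lambda\subseteq\mathbb{Z}_N$ belong to the family $\Lambda\big((\delta/\alpha)^2,(\delta/\alpha)^2,\lfloor\log(1/\delta)\rfloor\big)$ and satisfy $|\Lambda|\le 2^{-12}(\delta/\alpha)^2\log(1/\delta)$. Then there exists a set $A\subseteq\mathbb{Z}_N$ with $|A|=\lfloor\delta N\rfloor$ such that $\mathcal{R}_\alpha(A)=\{0\}\sqcup\Lambda\sqcup(-\Lambda)$.
   Context: $\mathbb{Z}_N=\mathbb{Z}/N\mathbb{Z}$; $\log$ is the logarithm to base $2$. For $f:\mathbb{Z}_N\to\mathbb{C}$, $\widehat f(r)=\sum_{n}f(n)e^{2\pi i nr/N}$; $A(x)$ is the indicator of $A$, and $\mathcal{R}_\alpha(A)=\{r\in\mathbb{Z}_N:|\widehat A(r)|\ge\alpha N\}$. Family $\Lambda(k,s,p)$: for positive integers $k,p$ and $s$ a positive integer or $\infty$, a set $\Lambda\subseteq\mathbb{Z}_N$ belongs to $\Lambda(k,s,p)$ if there is a partition of $\Lambda$ into $p$ subsets $\Lambda_1=\{\lambda^{(1)}_1,\dots,\lambda^{(1)}_{|\Lambda_1|}\},\dots,\Lambda_p=\{\lambda^{(p)}_1,\dots,\lambda^{(p)}_{|\Lambda_p|}\}$ such that the cardinalities of any two subsets $\Lambda_i,\Lambda_j$ differ by at most a factor of two, and such that any relation $\sum_{i=1}^p\sum_{j=1}^{|\Lambda_i|}s^{(i)}_j\lambda^{(i)}_j\equiv0\pmod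 N$ with integers $s^{(i)}_j$ satisfying $|s^{(i)}_j|\le s$ for all $i,j$ and $\sum_{j=1}^{|\Lambda_i|}|s^{(i)}_j|\le k$ for each $i=1,\dots,p$ forces all $s^{(i)}_j=0$. *)

(* Defs.v *)
From mathcomp Require Import all_boot all_order all_algebra.
From mathcomp Require Import Rstruct.
From Stdlib Require Import Reals.

Set Implicit Arguments.
Unset Strict Implicit.
Unset Printing Implicit Defensive.

(* Z_N is represented by 'I_N = {0,...,N-1} with arithmetic mod N. *)

Definition negZN (N : nat) (x : 'I_N) : 'I_N :=
  @Ordinal N ((N - x) %% N) (ltn_pmod (N - x) (leq_ltn_trans (leq0n x) (ltn_ord x))).

Definition negset (N : nat) (L : {set 'I_N}) : {set 'I_N} := [set negZN x | x in L].

Definition log2 (x : R) : R := (ln x / ln 2)%R.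

Definition floorR (x : R) : Z := Int_part x.

Definition fourier_re (N : nat) (A : {set 'I_N}) (r : 'I_N) : R :=
  (\big[Rplus/0]_(n in A) cos (2 * PI * INR n * INR r / INR N))%R.
Definition fourier_im (N : nat) (A : {set 'I_N}) (r : 'I_N) : R :=
  (\big[Rplus/0]_(n in A) sin (2 * PI * INR n * INR r / INR N))%R.
Definition fourier_abs (N : nat) (A : {set 'I_N}) (r : 'I_N) : R :=
  sqrt (fourier_re A r ^ 2 + fourier_im A r ^ 2)%R.

Definition large_spectrum (N : nat) (alpha : R) (A : {set 'I_N}) : {set 'I_N} :=
  [set r | if Rle_dec (alpha * INR N) (fourier_abs A r) then true else false].

(* The family Lambda(k,s,p), with real bounds k, s (the theorem uses
   k = s = (delta/alpha)^2, which need not be an integer).  The partition is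
   given as p pairwise disjoint blocks P i covering L; the coefficient
   s^{(i)}_j of lambda^{(i)}_j is c lambda^{(i)}_j (blocks are disjoint). *)
Local Open Scope ring_scope.
Definition in_Lambda_family (N : nat) (k s : R) (p : nat) (L : {set 'I_N}) : Prop :=
  exists P : 'I_p -> {set 'I_N},
    (forall i j : 'I_p, i != j -> [disjoint P i & P j]) /\
    (\bigcup_(i < p) P i = L) /\
    (forall i j : 'I_p, leq #|P i| (muln 2 #|P j|)) /\
    (forall c : 'I_N -> int,
        (forall x, x \in L -> Rle (INR (absz (c x))) s) ->
        (forall i : 'I_p, Rle (INR (\sum_(x in P i) absz (c x))) k) ->
        (\sum_(x in L) c x * Posz (nat_of_ord x)) \in dvdz (Posz N) ->
        forall x, x \in L -> c x = Posz 0).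

(* Main.v *)
(** The set A is a rounding of a Riesz product.  Put a = 8 alpha / delta and
    f(x) = delta * prod_i (1 + Im(prod_(l in Lambda_i) (1 + i a cos(2 pi l x / N))) / 2).
    Since |Lambda_i| <= 2^-11 (delta/alpha)^2, every factor lies in [0, 2], and
    delta * 2^p <= 1, so 0 <= f <= 1.  Expanding, dissociativity makes each
    frequency r arise from at most one choice of coefficients in {-1, 0, 1}, and a
    choice with k nonzero coefficients contributes at most delta N (a/2)^k.  Hence
    the transform of f is delta N at 0, has modulus delta N a / 4 = 2 alpha N on
    Lambda and -Lambda, and is at most 2^-23 alpha N elsewhere.

    To round f to a set with error O(sqrt N) at all N frequencies (independent
    rounding would lose a factor sqrt(log N)) one uses Spencer's six standard
    deviations theorem.  Fourth moments show that most colourings of an n-element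
    set have few large rows, so the vectors of truncated row sums take few values,
    two far apart colourings share a vector, and half their difference is a partial
    colouring with discrepancy O(sqrt N (n/N)^(1/8)).  Iterating gives full
    colourings with discrepancy O(sqrt N), and these round f one binary digit at a
    time. *)

Require Import Defs.
From mathcomp Require Import all_boot all_order all_algebra.
From mathcomp Require Import Rstruct.
From Stdlib Require Import Reals.
From mathcomp Require Import complex ring lra zify.
Import Order.TTheory GRing.Theory Num.Theory.

Set Implicit Arguments.
Unset Strict Implicit.
Unset Printing Implicit Defensive.
(* Otherwise a numeral k expected of type R would be read as [IZR k] rather than [k%:R]. *)
Bind Scope ring_scope with R.
#[local] Arguments exp x%_ring_scope.
#[local] Arguments cos x%_ring_scope.
#[local] Arguments sin x%_ring_scope.
Local Open Scope ring_scope.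

(** * Moments and entropy of random colourings *)

Lemma exp_gt0 (x : R) : 0 < exp x.
Proof. by apply/RltP; exact: exp_pos. Qed.

Lemma exp_ge1Dx (x : R) : 1 + x <= exp x.
Proof. by apply/RleP; exact: exp_ineq1_le. Qed.

Lemma expD (x y : R) : exp (x + y) = exp x * exp y.
Proof. exact: exp_plus. Qed.

Lemma expN_mul (x : R) : exp x * exp (- x) = 1.
Proof. by rewrite -[LHS]exp_plus [X in exp X]Rplus_opp_r exp_0. Qed.

Lemma ler_exp (x y : R) : x <= y -> exp x <= exp y.
Proof.
move/RleP; case=> [lt|->]; last exact: lexx.
by apply/RleP/Rlt_le/exp_increasing.
Qed.

Lemma set_insert_ind (T : finType) (P : {set T} -> Prop) :
  P set0 -> (forall (x : T) (S : {set T}), x \notin S -> P S -> P (x |: S)) -> forall S, P S.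
Proof.
move=> P0 PU S; have [n] := ubnP #|S|; elim: n S => // n IHn S.
have [-> //|[x xS]] := set_0Vmem S.
rewrite (cardsD1 x) xS ltnS -{2}(setD1K xS) => leSn.
by apply: PU; [rewrite !inE eqxx | apply: IHn].
Qed.

(** Each subset of [x |: S] either avoids [x] or arises by adding [x] to one that does; this split
    drives the moment inductions below. *)
Lemma sum_powersetU1 (T : finType) (V : nmodType) (x : T) (S : {set T})
    (F : {set T} -> V) :
  x \notin S ->
  \sum_(X in powerset (x |: S)) F X = \sum_(X in powerset S) (F X + F (x |: X)).
Proof.
move=> xS; rewrite big_split /= addrC (bigID (fun X : {set T} => x \in X)) /=.
congr (_ + _).
  rewrite (reindex_onto (fun X => x |: X) (fun X => X :\ x)) /=; last first.
    by move=> X /andP[_ xX]; rewrite setD1K.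
  apply: eq_bigl => X; rewrite !inE eqxx orTb andbT.
  apply/idP/idP => [/andP[sX /eqP <-]|sX].
    by rewrite subDset.
  rewrite setUS //= setU1K //; apply: contra xS; exact: (subsetP sX).
apply: eq_bigl => X; rewrite !inE; apply/idP/idP => [/andP[sX xX]|sX].
  by rewrite -(setU1K xS) subsetD1 sX.
rewrite (subset_trans sX (subsetUr _ _)) /=.
by apply: contra xS; exact: (subsetP sX).
Qed.

Lemma sum_powerset_expr (T : finType) (S : {set T}) (q : R) :
  \sum_(X in powerset S) q ^+ #|X| = (1 + q) ^+ #|S|.
Proof.
elim/set_insert_ind: S => [|x S xS IH].
  by rewrite powerset0 big_set1 !cards0 !expr0.
rewrite sum_powersetU1 // cardsU1 xS exprS -IH big_distrr /=.
apply: eq_bigr => X; rewrite inE => sX; rewrite cardsU1.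
suff -> : x \notin X by rewrite exprS mulrDl mul1r.
by apply: contra xS; exact: (subsetP sX).
Qed.

(** A colouring is encoded by the set [X] of its points of sign +1, so averaging over colourings of
    [S] is averaging over [powerset S]. *)
Definition sgn_in (T : finType) (X : {set T}) (x : T) : R :=
  if x \in X then 1 else -1.

Definition signed_sum (T : finType) (b : T -> R) (S X : {set T}) : R :=
  \sum_(x in S) sgn_in X x * b x.

Section Moments.
Variables (T : finType) (b : T -> R).

Lemma signed_sumU1 (x : T) (S X : {set T}) : x \notin S -> X \subset S ->
  signed_sum b (x |: S) X = signed_sum b S X - b x.
Proof.
move=> xS sX; rewrite /signed_sum big_setU1 //= {1}/sgn_in ifN ?mulN1r 1?addrC //.
by apply: contra xS; exact: (subsetP sX).
Qed.

Lemma signed_sumU1U1 (x : T) (S X : {set T}) : x \notin S -> X \subset S ->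
  signed_sum b (x |: S) (x |: X) = signed_sum b S X + b x.
Proof.
move=> xS sX; rewrite /signed_sum big_setU1 //= {1}/sgn_in setU11 mul1r addrC.
congr (_ + _); apply: eq_bigr => y yS; rewrite /sgn_in !inE.
by case: eqP => // yx; rewrite -yx yS in xS.
Qed.

Hypothesis b_le1 : forall x, `|b x| <= 1.

Let b2_le1 x : b x ^+ 2 <= 1.
Proof. by rewrite -real_normK ?num_real // expr_le1. Qed.

Lemma signed_sum_moment2 (S : {set T}) :
  \sum_(X in powerset S) signed_sum b S X ^+ 2 <= #|S|%:R * 2 ^+ #|S|.
Proof.
elim/set_insert_ind: S => [|x S xS IH].
  by rewrite powerset0 big_set1 cards0 mul0r /signed_sum big_set0 expr0n.
rewrite sum_powersetU1 // cardsU1 xS.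
apply: (@le_trans _ _ (\sum_(X in powerset S) (2 * signed_sum b S X ^+ 2 + 2))).
  apply: ler_sum => X; rewrite inE => sX.
  rewrite signed_sumU1 // signed_sumU1U1 //; have := b2_le1 x; nra.
rewrite big_split /= -big_distrr /= sumr_const card_powerset.
rewrite -[_ *+ expn _ _]mulr_natr natrX natrD exprD expr1; nra.
Qed.

(** Inserting [x] replaces a sum r by r - b and r + b, whose fourth powers add to 2r^4 + 12r^2b^2 +
    2b^4. With the second moment bound the induction closes, as 6n^2 + 12n + 2 <= 6(n + 1)^2. *)
Lemma signed_sum_moment4 (S : {set T}) :
  \sum_(X in powerset S) signed_sum b S X ^+ 4 <= 3 * #|S|%:R ^+ 2 * 2 ^+ #|S|.
Proof.
elim/set_insert_ind: S => [|x S xS IH].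
  by rewrite powerset0 big_set1 cards0 /signed_sum big_set0 !expr0n mulr0 mul0r.
rewrite sum_powersetU1 // cardsU1 xS.
apply: (@le_trans _ _ (\sum_(X in powerset S)
    (2 * signed_sum b S X ^+ 4 + (12 * signed_sum b S X ^+ 2 + 2)))).
  apply: ler_sum => X; rewrite inE => sX.
  rewrite signed_sumU1 // signed_sumU1U1 //; have := b2_le1 x.
  set r := signed_sum b S X; move: (sqr_ge0 r) (sqr_ge0 (b x)).
  have -> : (r - b x) ^+ 4 + (r + b x) ^+ 4 =
    2 * r ^+ 4 + (12 * (r ^+ 2 * b x ^+ 2) + 2 * (b x ^+ 2 * b x ^+ 2)) by ring.
  move: (r ^+ 2) (b x ^+ 2) (r ^+ 4) => u v w u0 v0 v1.
  have : u * v <= u by rewrite ler_piMr.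
  have : v * v <= 1 by rewrite mulr_ile1.
  lra.
rewrite !big_split /= -!big_distrr /= sumr_const card_powerset.
rewrite -[_ *+ expn _ _]mulr_natr natrX natrD exprD expr1.
have := signed_sum_moment2 S; have : 0 <= (2 : R) ^+ #|S| by rewrite exprn_ge0 ?ler0n.
move: IH; set n := #|S|%:R; set p := 2 ^+ _.
move: (\sum_(X in _) _) => u; move: (\sum_(X in _) _) => v; nra.
Qed.

End Moments.

(** * Counting close colourings and low-cost bucket vectors *)

Lemma bernoulli (h : R) (n : nat) : 0 <= h -> 1 + n%:R * h <= (1 + h) ^+ n.
Proof.
move=> h0; elim: n => [|n IHn]; first by rewrite mul0r addr0 expr0.
have hn : 0 <= n%:R :> R by rewrite ler0n.
by rewrite exprS -natr1; nra.
Qed.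

Definition symdiff (T : finType) (X Y : {set T}) : {set T} := (X :\: Y) :|: (Y :\: X).

Lemma symdiffK (T : finType) (X : {set T}) : involutive (symdiff X).
Proof.
by move=> Y; apply/setP => x; rewrite !inE; case: (x \in X); case: (x \in Y).
Qed.

(* Giving D the weight (81/256)^|D| = (3/4)^(4|D|), the hypothesis bounds the
   weight of each symmetric difference below by (3/4)^|S|. *)
Lemma card_close_family (T : finType) (S X : {set T}) (G : {set {set T}}) :
  X \subset S -> G \subset powerset S ->
  (forall Y, Y \in G -> (4 * #|symdiff X Y| <= #|S|)%nat) ->
  #|G|%:R <= (337 / 192 : R) ^+ #|S|.
Proof.
move=> sX sG close.
have q0 : (0 : R) <= 81 / 256 by lra.
have p0 : 0 < (3 / 4 : R) ^+ #|S| by rewrite exprn_gt0 //; lra.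
rewrite -(ler_pM2r p0) -exprMn.
have -> : 337 / 192 * (3 / 4) = 1 + 81 / 256 :> R by field.
rewrite -sum_powerset_expr -sum1_card natr_sum mulr_suml.
apply: (@le_trans _ _ (\sum_(Y in G) (81 / 256 : R) ^+ #|symdiff X Y|)).
  apply: ler_sum => Y YG; rewrite mul1r.
  have -> : 81 / 256 = (3 / 4) ^+ 4 :> R by field.
  rewrite -exprM; apply: ler_wiXn2l; [lra | lra | exact: close].
(* Since [symdiff X] is injective, these are weights of distinct subsets of [S], part of the total
   (1 + 81/256)^|S|. *)
rewrite -(big_imset (fun D : {set T} => (81 / 256 : R) ^+ #|D|)) /=; last first.
  by move=> Y Z _ _; apply: (can_inj (symdiffK X)).
rewrite [leRHS](bigID (mem [set symdiff X Y | Y in G])) /=.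
apply: (@le_trans _ _ (\sum_(D in powerset S | D \in [set symdiff X Y | Y in G])
    (81 / 256 : R) ^+ #|D|)); last first.
  by rewrite lerDl; apply: sumr_ge0 => D _; apply: exprn_ge0.
rewrite le_eqVlt; apply/orP; left; apply/eqP; apply: eq_bigl => D.
apply/idP/idP => [DG|/andP[]//]; rewrite DG andbT.
case/imsetP: DG => Y YG ->; move/subsetP: sG => /(_ Y YG); rewrite !inE => sY.
by rewrite subUset !subDset !subsetU ?sX ?sY ?orbT.
Qed.

(** The entry (0, false) weighs 0, (0, true) weighs 1, and both signs of k > 0 weigh x^k, so the
    total is at most 1 + 2x/(1 - x), where 1/(1 - x) <= 2. *)
Lemma sum_signed_weights (M : nat) (x : R) : 0 <= x -> x <= 1 / 2 ->
  \sum_(e : 'I_M * bool) (if val e.1 == 0%nat then e.2%:R else x ^+ e.1) <= 1 + 4 * x.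
Proof.
move=> x0 x_le.
rewrite -(pair_bigA _ (fun (k : 'I_M) (s : bool) =>
  if val k == 0%nat then s%:R else x ^+ k)) /=.
case: M => [|M]; first by rewrite big_ord0; lra.
rewrite big_ord_recl /= big_bool /= addr0 lerD2l.
have -> : \sum_(k < M) \sum_(s : bool)
    (if bump 0 k == 0%nat then s%:R else x ^+ bump 0 k) = 2 * x * \sum_(k < M) x ^+ k.
  rewrite big_distrr /=; apply: eq_bigr => k _.
  by rewrite big_bool /= /bump leq0n add1n /= exprS; ring.
have := subrX1 x M; have : 0 <= x ^+ M by rewrite exprn_ge0.
set g := \sum_(k < M) _; nra.
Qed.

(** An exponential weight count. With x = exp(-L), a vector of total index at most [B] has product
    weight at least exp(-LB), while all vectors together weigh at most (1 + 4x)^|J| <= exp(4x|J|).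
    Requiring the flag [true] at index 0 makes that bucket count once. *)
Lemma card_signed_classes (J : finType) (M : nat)
    (C : {set {ffun J -> 'I_M * bool}}) (B L : R) :
  0 < B -> 0 <= L -> exp (- L) <= 1 / 2 ->
  (forall c, c \in C -> forall j, val (c j).1 = 0%nat -> (c j).2) ->
  (forall c, c \in C -> \sum_j (val (c j).1)%:R <= B) ->
  #|C|%:R <= exp (L * B + 4 * exp (- L) * #|J|%:R).
Proof.
move=> B0 L0 x_le zeroT costB; set x := exp (- L) in x_le *.
have x0 : 0 < x by apply: exp_gt0.
pose v (e : 'I_M * bool) : R := if val e.1 == 0%nat then e.2%:R else x ^+ e.1.
have v0 e : 0 <= v e.
  by rewrite /v; case: ifP => _; [rewrite ler0n | rewrite exprn_ge0 // ltW].
have v_sum : \sum_e v e <= 1 + 4 * x.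
  by apply: sum_signed_weights => //; apply: ltW.
have -> : L * B + 4 * x * #|J|%:R = L * B + (4 * x) *+ #|J| by rewrite mulr_natr.
rewrite -expRD -expRX.
have step : #|C|%:R * exp (- (L * B)) <= \sum_(c : {ffun J -> 'I_M * bool}) \prod_j v (c j).
  rewrite -sum1_card natr_sum mulr_suml [leRHS](bigID (mem C)) /=.
  rewrite -[leLHS]addr0; apply: lerD; last first.
    by apply: sumr_ge0 => c _; apply: prodr_ge0.
  apply: ler_sum => c cC; rewrite mul1r.
  have -> : \prod_j v (c j) = exp (- (L * \sum_j (val (c j).1)%:R)).
    rewrite (eq_bigr (fun j => exp (- (L * (val (c j).1)%:R)))).
      rewrite big_distrr /= -sumrN.
      by elim/big_rec2: _ => [|j y z _ ->]; rewrite ?expR0 // expRD.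
    move=> j _; rewrite /v; case: eqP => [z|_].
      by rewrite zeroT // z mulr0 oppr0 expR0.
    by rewrite /x expRX -mulNr mulr_natr.
  by apply: ler_exp; rewrite lerN2 ler_wpM2l // costB.
rewrite -(bigA_distr_bigA (fun (j : J) e => v e)) prodr_const in step.
rewrite -(ler_pM2r (exp_gt0 (- (L * B)))) mulrAC expN_mul mul1r; apply: le_trans step _.
rewrite lerXn2r ?nnegrE ?sumr_ge0 //.
  by apply/ltW/exp_gt0.
by apply: le_trans v_sum _; exact: exp_ge1Dx.
Qed.

(** * Most colourings have small truncated row sums *)

Lemma trunc_le_pow4 (y : R) : 0 <= y -> (Num.trunc y)%:R <= y ^+ 4.
Proof.
move=> y0; have [y1|y1] := ltP y 1.
  have -> : Num.trunc y = 0%nat by apply/eqP; rewrite truncn_eq // y0 y1.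
  exact: exprn_ge0.
apply: (@le_trans _ _ y); first by rewrite truncn_le.
by rewrite -[leLHS]expr1 ler_weXn2l.
Qed.

Definition row_cost (T J : finType) (a : J -> T -> R) (w : R) (S X : {set T}) : R :=
  \sum_j (Num.trunc (`|signed_sum (a j) S X| / w))%:R.

(** Markov's inequality: truncation is bounded by a fourth power, so fourth moments bound the mean
    cost by [B / 2], and at least half of the colourings cost at most [B]. *)
Lemma card_balanced (T J : finType) (a : J -> T -> R) (S : {set T}) (w B : R) :
  (forall j x, `|a j x| <= 1) -> 0 < w -> 0 < B ->
  #|J|%:R * (3 * #|S|%:R ^+ 2) / w ^+ 4 <= B / 2 ->
  (2 ^+ #|S| : R) <= 2 * #|[set X in powerset S | row_cost a w S X <= B]|%:R.
Proof.
move=> ha w0 B0 small.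
have cost0 X : 0 <= row_cost a w S X by apply: sumr_ge0 => j _; rewrite ler0n.
have cost_sum : \sum_(X in powerset S) row_cost a w S X <= 2 ^+ #|S| * (B / 2).
  apply: (@le_trans _ _ (\sum_(X in powerset S) \sum_j (signed_sum (a j) S X ^+ 4 / w ^+ 4))).
    apply: ler_sum => X _; apply: ler_sum => j _.
    apply: le_trans (trunc_le_pow4 _) _; first by rewrite divr_ge0 // ltW.
    by rewrite exprMn exprVn -normrX ger0_norm // exprn_even_ge0.
  rewrite exchange_big /=.
  apply: (@le_trans _ _ (\sum_(j : J) (3 * #|S|%:R ^+ 2 * 2 ^+ #|S|) / w ^+ 4)).
    apply: ler_sum => j _; rewrite -mulr_suml ler_pM2r ?invr_gt0 ?exprn_gt0 //.
    exact: signed_sum_moment4.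
  rewrite sumr_const -[leLHS]mulr_natl.
  have -> : #|J|%:R * (3 * #|S|%:R ^+ 2 * 2 ^+ #|S| / w ^+ 4) =
    2 ^+ #|S| * (#|J|%:R * (3 * #|S|%:R ^+ 2) / w ^+ 4) by ring.
  by apply: ler_wpM2l => //; rewrite exprn_ge0.
pose good (X : {set T}) := row_cost a w S X <= B.
(* Markov pointwise: 1 is at most the indicator of cost <= B plus cost / B. *)
have count : (2 ^+ #|S| : R) <=
    #|[set X in powerset S | good X]|%:R + (\sum_(X in powerset S) row_cost a w S X) / B.
  have -> : (2 ^+ #|S| : R) = \sum_(X in powerset S) 1.
    by rewrite sumr_const card_powerset natrX.
  have -> : #|[set X in powerset S | good X]|%:R =
      \sum_(X in powerset S) (good X)%:R :> R.
    rewrite -sum1_card natr_sum (eq_bigl (fun X => (X \in powerset S) && good X)).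
      by rewrite big_mkcondr; apply: eq_bigr => X _; case: (good X).
    by move=> X; rewrite inE.
  rewrite mulr_suml -big_split /=; apply: ler_sum => X _.
  have c0 := cost0 X; rewrite /good; have [_|lt] := leP (row_cost a w S X) B.
    rewrite -[leLHS]addr0; apply: lerD; first exact: lexx.
    by rewrite divr_ge0 // ltW.
  rewrite -[leLHS]add0r; apply: lerD; first exact: lexx.
  by rewrite ler_pdivlMr // mul1r ltW.
have : (\sum_(X in powerset S) row_cost a w S X) / B <= 2 ^+ #|S| / 2.
  rewrite ler_pdivrMr //; apply: le_trans cost_sum _.
  by rewrite le_eqVlt; apply/orP; left; apply/eqP; ring.
by move: count; rewrite /good; move: (2 ^+ _) => p; lra.
Qed.

(** Half the difference of two colourings is a partial colouring: +1 on X \ Y, -1 on Y \ X, and 0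
    where they agree. *)
Lemma signed_sumB (T : finType) (b : T -> R) (S X Y : {set T}) :
  X \subset S -> Y \subset S ->
  signed_sum b S X - signed_sum b S Y =
  2 * (\sum_(x in X :\: Y) b x - \sum_(x in Y :\: X) b x).
Proof.
move=> sX sY; rewrite /signed_sum -sumrB.
rewrite (big_mkcond (mem S)) (big_mkcond (mem (X :\: Y))) (big_mkcond (mem (Y :\: X))) /=.
rewrite -sumrB mulr_sumr; apply: eq_bigr => x _.
rewrite /sgn_in !inE; have := subsetP sX x; have := subsetP sY x.
case: (x \in S); case: (x \in X); case: (x \in Y) => //= h1 h2;
  by [ring | move: (h1 isT) | move: (h2 isT)].
Qed.

(** * From colourings in the same buckets to a partial colouring *)

Lemma trunc_eq_dist (y z : R) : 0 <= y -> 0 <= z ->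
  Num.trunc y = Num.trunc z -> `|y - z| <= 1.
Proof.
move=> y0 z0 e; have /andP[] := truncn_itv y0; have /andP[] := truncn_itv z0.
rewrite e -natr1 ler_norml => *; apply/andP; split; lra.
Qed.

(** The eighth root. The scale [w] contains it so that w^4, which divides the fourth moments,
    contains the square root of n/N. *)
Definition root8 (x : R) : R := Num.sqrt (Num.sqrt (Num.sqrt x)).

Lemma root8_gt0 (x : R) : 0 < x -> 0 < root8 x.
Proof. by move=> x0; rewrite !sqrtr_gt0. Qed.

Lemma root8_pow4 (x : R) : root8 x ^+ 4 = Num.sqrt x.
Proof. by rewrite (exprM _ 2 2) !sqr_sqrtr ?sqrtr_ge0. Qed.

(** From s/2 <= exp(s/2 - 1) and e >= 2 follows s <= exp(s/2), which is then squared. It serves to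
    bound exp(-L) by L^-2. *)
Lemma sqr_le_exp (s : R) : 0 <= s -> s ^+ 2 <= exp s.
Proof.
move=> s0; have e1 : 2 <= exp 1 by have := exp_ge1Dx 1; lra.
have e2 : s <= exp (s / 2).
  have -> : exp (s / 2) = exp 1 * exp (s / 2 - 1).
    by rewrite -expD; congr exp; ring.
  have := exp_ge1Dx (s / 2 - 1); have := exp_gt0 (s / 2 - 1); nra.
have -> : exp s = exp (s / 2) ^+ 2.
  by rewrite expr2 -expD; congr exp; field.
by rewrite lerXn2r ?nnegrE // (le_trans s0 e2).
Qed.
(** In bucket 0 both values are below [w] in modulus. In any other bucket the flag forces equal
    signs, so the distance is that of the absolute values, at most [w]. *)
Lemma same_bucket_dist (w u v : R) : 0 < w ->
  Num.trunc (`|u| / w) = Num.trunc (`|v| / w) ->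
  (Num.trunc (`|v| / w) == 0%nat) || (0 <= u) =
  (Num.trunc (`|v| / w) == 0%nat) || (0 <= v) ->
  `|u - v| <= 2 * w.
Proof.
move=> w0 kE; have [k0 _|_ /= sE] := eqVneq (Num.trunc (`|v| / w)) 0%nat.
  have lt1 (z : R) : Num.trunc (`|z| / w) = 0%nat -> `|z| < w.
    move=> z0; have /andP[_] : (Num.trunc (`|z| / w))%:R <= `|z| / w <
      (Num.trunc (`|z| / w)).+1%:R by apply: truncn_itv; rewrite divr_ge0 // ltW.
    by rewrite z0 ltr_pdivrMr // mul1r.
  apply: le_trans (ler_normB _ _) _.
  by have := lt1 u (etrans kE k0); have := lt1 v k0; lra.
apply: (@le_trans _ _ w); last by lra.
have -> : `|u - v| = `| `|u| - `|v| |.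
  move: sE; have [u0|u0] := leP 0 u; have [v0|v0] := leP 0 v => // _.
    by rewrite (ger0_norm u0) (ger0_norm v0).
  by rewrite (ltr0_norm u0) (ltr0_norm v0) [LHS]distrC; congr (`|_|); ring.
have : `| `|u| / w - `|v| / w | <= 1.
  by apply: trunc_eq_dist => //; rewrite divr_ge0 // ltW.
by rewrite -mulrBl normrM normfV (gtr0_norm w0) ler_pdivrMr // mul1r.
Qed.

(** [B] caps the total bucket index and [L] is the exponent in [card_signed_classes]. With rho =
    n/N, [B] is proportional to n sqrt(rho) and [L] to 1/sqrt(rho), so [L * B] is linear in n;
    exp(-L) <= rho/160 makes the other term at most linear in n too. *)
Lemma coloring_parameters (n N : nat) (w : R) :
  (0 < n)%nat -> (n <= N)%nat ->
  w = 69 / 10 * Num.sqrt N%:R * root8 (n%:R / N%:R) ->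
  exists B L : R, [/\ 0 < w, 0 < B, 2 * N%:R * (3 * n%:R ^+ 2) / w ^+ 4 <= B / 2,
    0 <= L & exp (- L) <= 1 / 2] /\
    exp (L * B + 4 * exp (- L) * (2 * N%:R)) <= (25 / 22) ^+ n.
Proof.
move=> n_gt0 leSN wE; set rho := n%:R / N%:R in wE.
have nR0 : 0 < n%:R :> R by rewrite ltr0n.
have leNn : n%:R <= N%:R :> R by rewrite ler_nat.
have N0 : 0 < N%:R :> R by exact: lt_le_trans nR0 leNn.
have rho0 : 0 < rho by rewrite divr_gt0.
have rho1 : rho <= 1 by rewrite ler_pdivrMr // mul1r.
have c0 : 0 < 69 / 10 :> R by rewrite divr_gt0 ?ltr0n.
pose s := Num.sqrt rho; have s0 : 0 < s by rewrite sqrtr_gt0.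
have s2 : s ^+ 2 = rho by rewrite sqr_sqrtr // ltW.
have nE : n%:R = s ^+ 2 * N%:R :> R by rewrite s2 /rho divfK // gt_eqF.
have w0 : 0 < w.
  by rewrite wE mulr_gt0 ?root8_gt0 // mulr_gt0 ?sqrtr_gt0.
have w4 : w ^+ 4 = (69 / 10) ^+ 4 * N%:R ^+ 2 * s.
  rewrite wE !exprMn root8_pow4 -/s; congr (_ * _ * _).
  by rewrite (exprM _ 2 2) sqr_sqrtr // ltW.
pose B : R := (11 / 2000) * n%:R * s.
have B0 : 0 < B by rewrite !mulr_gt0 // invr_gt0 ltr0n.
pose L := Num.sqrt (160 / rho).
have L0 : 0 <= L by exact: sqrtr_ge0.
have L2 : L ^+ 2 = 160 / rho by rewrite sqr_sqrtr // divr_ge0 // ltW.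
have xL : exp (- L) <= rho / 160.
  have := sqr_le_exp L0; rewrite L2 => h.
  have e1 := expN_mul L; have e0 := exp_gt0 (- L).
  have h2 : exp (- L) * (160 / rho) <= 1 by rewrite -[leRHS]e1 [leLHS]mulrC ler_pM2r.
  move: h2; rewrite mulrA ler_pdivrMr // mul1r => h2; lra.
have LB : L * B <= (7 / 100) * n%:R.
  have : (L * s) ^+ 2 <= (253 / 20) ^+ 2.
    by rewrite exprMn L2 s2 divfK ?gt_eqF //; lra.
  move=> h; have Ls : L * s <= (253 / 20).
    by rewrite -(@ler_pXn2r _ 2) ?nnegrE ?mulr_ge0 ?(ltW s0) //; lra.
  have -> : L * B = (L * s) * ((11 / 2000) * n%:R) by rewrite /B; ring.
  have : 0 <= (11 / 2000) * n%:R :> R by rewrite mulr_ge0 ?divr_ge0 ?ler0n.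
  by move/(ler_wpM2r) => /(_ _ _ Ls); lra.
exists B, L; split; first split => //.
(* The constant 69/10 satisfies (11/4000)(69/10)^4 >= 6, as this inequality demands. *)
- rewrite w4 ler_pdivrMr; last first.
    by rewrite mulr_gt0 // mulr_gt0 ?(exprn_gt0 _ N0) ?(exprn_gt0 _ c0).
  have -> : B / 2 * ((69 / 10) ^+ 4 * N%:R ^+ 2 * s) =
      ((11 / 4000) * (69 / 10) ^+ 4) * N%:R * n%:R * (s ^+ 2 * N%:R) by rewrite /B; field.
  rewrite -nE.
  have -> : 2 * N%:R * (3 * n%:R ^+ 2) = 6 * N%:R * n%:R * n%:R :> R by ring.
  by rewrite !ler_wpM2r ?ler0n //; lra.
- by apply: le_trans xL _; lra.
(* The two exponents are at most 7n/100 and n/20, with sum 3n/25; then exp(3/25) <= 1/(1 - 3/25) =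
   25/22. *)
apply: (@le_trans _ _ (exp (3 / 25 *+ n))).
  apply: ler_exp; rewrite -[3 / 25 *+ n]mulr_natr.
  have : 4 * exp (- L) * (2 * N%:R) <= n%:R / 20.
    apply: (@le_trans _ _ (4 * (rho / 160) * (2 * N%:R))); last by rewrite nE s2; lra.
    by rewrite ler_pM2r ?mulr_gt0 // ler_pM2l.
  by move: LB; lra.
rewrite -expRX; apply: lerXn2r; rewrite ?nnegrE ?(ltW (exp_gt0 _)) ?divr_ge0 ?ler0n //.
have h1 := exp_ge1Dx (- (3 / 25)); have h2 := expN_mul (3 / 25).
have : exp (3 / 25) * (1 - 3 / 25) <= 1 by rewrite -[leRHS]h2 ler_pM2l // exp_gt0.
by lra.
Qed.

(* Pigeonhole: few values of the bucket vector [cl] on the many balanced colourings [G], while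
   colourings that are pairwise close number at most (337/192)^n. *)
Lemma partial_coloring (T J : finType) (a : J -> T -> R) (N : nat) (S : {set T}) :
  (forall j x, `|a j x| <= 1) -> (#|J| <= 2 * N)%nat -> (#|S| <= N)%nat ->
  (1024 <= #|S|)%nat ->
  exists U V : {set T}, [/\ U \subset S, V \subset S, [disjoint U & V],
    (#|S| <= 4 * #|U :|: V|)%nat &
    forall j, `|\sum_(x in U) a j x - \sum_(x in V) a j x| <=
      (69 / 10) * Num.sqrt N%:R * root8 (#|S|%:R / N%:R)].
Proof.
move=> ha leJ leSN geS; set n := #|S| in leSN geS *.
set w : R := 69 / 10 * _ * _.
have [B [L [[w0 B0 wB L0 xL] classes]]] :=
  coloring_parameters (leq_trans (isT : (0 < 1024)%nat) geS) leSN (erefl w).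
have leJR : #|J|%:R <= 2 * N%:R :> R by rewrite -natrM ler_nat.
pose G := [set X in powerset S | row_cost a w S X <= B].
have GS : G \subset powerset S by apply/subsetP => X; rewrite inE => /andP[].
have bigG : (2 ^+ n : R) <= 2 * #|G|%:R.
  apply: card_balanced => //; apply: le_trans wB.
  rewrite ler_pM2r ?invr_gt0 ?exprn_gt0 // ler_wpM2r //.
  by rewrite mulr_ge0 ?exprn_ge0 ?ler0n.
pose k j X := Num.trunc (`|signed_sum (a j) S X| / w).
(* [M] bounds every bucket index, so that bucket vectors live in a finite type. *)
pose M := \max_j \max_(X : {set T}) k j X.
have kM j X : (k j X < M.+1)%nat.
  by rewrite ltnS (leq_trans _ (leq_bigmax j)) // leq_bigmax.
pose cl X : {ffun J -> 'I_M.+1 * bool} :=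
  [ffun j => (inord (k j X), (k j X == 0%nat) || (0 <= signed_sum (a j) S X))].
have clK j X : val (cl X j).1 = k j X by rewrite ffunE /= inordK.
have few : #|[set cl X | X in G]|%:R <= (25 / 22 : R) ^+ n.
  apply: (@le_trans _ _ (exp (L * B + 4 * exp (- L) * #|J|%:R))).
    apply: card_signed_classes => //.
    - by move=> _ /imsetP[X _ ->] j; rewrite clK ffunE /= => ->.
    - move=> _ /imsetP[X XG ->]; rewrite (eq_bigr (fun j => (k j X)%:R)).
        by move: XG; rewrite inE => /andP[].
      by move=> j _; rewrite clK.
  apply: le_trans classes.
  apply: ler_exp; rewrite lerD2l ler_wpM2l //.
  by rewrite mulr_ge0 ?ler0n // ltW // exp_gt0.
have [/existsP[X /existsP[Y /and4P[XG YG /eqP clE far]]]|near] := boolP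
  [exists X, exists Y, [&& X \in G, Y \in G, cl X == cl Y & (n < 4 * #|symdiff X Y|)%nat]].
  have sX : X \subset S by move/subsetP/(_ X XG): GS; rewrite inE.
  have sY : Y \subset S by move/subsetP/(_ Y YG): GS; rewrite inE.
  exists (X :\: Y), (Y :\: X); split.
  - exact: subset_trans (subsetDl _ _) sX.
  - exact: subset_trans (subsetDl _ _) sY.
  - by apply/pred0P => x /=; rewrite !inE; case: (x \in X); case: (x \in Y).
  - exact: ltnW.
  move=> j.
  suff : `|signed_sum (a j) S X - signed_sum (a j) S Y| <= 2 * w.
    by rewrite signed_sumB // normrM ger0_norm //; lra.
  have kE : k j X = k j Y by rewrite -!clK clE.
  have := congr1 (fun c : {ffun J -> 'I_M.+1 * bool} => (c j).2) clE.
  rewrite /= !ffunE /= kE.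
  by move=> sE; apply: same_bucket_dist sE.
(* No two colourings of a class differ on more than a quarter of [S], so each class is a close
   family. *)
have small c : #|[set X in G | cl X == c]|%:R <= (337 / 192 : R) ^+ n.
  have [->|[X]] := set_0Vmem [set X in G | cl X == c].
    by rewrite cards0 exprn_ge0 //; lra.
  rewrite inE => /andP[XG /eqP Xc].
  apply: (@card_close_family _ S X).
  - by move/subsetP/(_ X XG): GS; rewrite inE.
  - by apply/subsetP => Y; rewrite inE => /andP[/(subsetP GS)].
  move=> Y; rewrite inE => /andP[YG /eqP Yc]; rewrite leqNgt; apply/negP => far.
  case/existsP: near; exists X; apply/existsP; exists Y.
  by rewrite XG YG Xc Yc eqxx.
have Gle : #|G|%:R <= #|[set cl X | X in G]|%:R * (337 / 192 : R) ^+ n.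
  rewrite -sum1_card (partition_big_imset cl) /= natr_sum.
  rewrite mulr_natl -sumr_const; apply: ler_sum => c _.
  rewrite sum1_card; apply: le_trans (small c).
  by rewrite ler_nat; apply: eq_leq; apply: eq_card => X; rewrite [RHS]in_set.
(* The counts give 2^n <= 2(25/22 * 337/192)^n. But 2 / (25/22 * 337/192) = 1 + 23/8425, whose n-th
   power exceeds 2 for n >= 1024 by Bernoulli. *)
exfalso; have n0 : 1024 <= n%:R :> R by rewrite (ler_nat _ 1024 n).
have q0 : 0 <= (337 / 192 : R) ^+ n by rewrite exprn_ge0 //; lra.
have : (2 ^+ n : R) <= 2 * ((25 / 22) ^+ n * (337 / 192) ^+ n).
  apply: le_trans bigG _; rewrite ler_pM2l //; apply: le_trans Gle _.
  by rewrite ler_wpM2r.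
have p0 : 0 < (25 / 22 * (337 / 192) : R) ^+ n by rewrite exprn_gt0 //; lra.
rewrite -exprMn -ler_pdivrMr // -exprVn -exprMn.
have := @bernoulli (2 * (25 / 22 * (337 / 192))^-1 - 1) n.
have -> : 1 + (2 * (25 / 22 * (337 / 192))^-1 - 1) =
  2 * (25 / 22 * (337 / 192))^-1 :> R by ring.
have -> : 2 * (25 / 22 * (337 / 192))^-1 = 1 + (23 / 25) / 337 :> R by field.
move: (_ ^+ n) => z; nra.
Qed.
(** * From partial colourings to rounding *)

Lemma root8M (x y : R) : 0 <= x -> root8 (x * y) = root8 x * root8 y.
Proof. by move=> x0; rewrite /root8 !sqrtrM ?sqrtr_ge0. Qed.

Lemma ler_root8 (x y : R) : x <= y -> root8 x <= root8 y.
Proof. by move=> xy; rewrite /root8 !ler_wsqrtr. Qed.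

Lemma root8_pow8 (x : R) : 0 <= x -> root8 (x ^+ 8) = x.
Proof.
move=> x0; rewrite (exprM _ 4 2) (exprM _ 2 2) /root8.
by do 3![rewrite sqrtr_sqr ger0_norm ?exprn_ge0 //].
Qed.

(** The ratio works because (193/200)^8 >= 3/4. *)
Lemma root8_contract (x y : R) : 0 <= x -> y <= 3 / 4 * x ->
  root8 y <= 193 / 200 * root8 x.
Proof.
move=> x0 yx; have c0 : 0 <= 193 / 200 :> R by lra.
rewrite -(root8_pow8 c0) -root8M ?exprn_ge0 //.
by apply/ler_root8/(le_trans yx); rewrite ler_wpM2r //; lra.
Qed.

Lemma norm_sum_le_card (T : finType) (b : T -> R) (S : {set T}) :
  (forall x, `|b x| <= 1) -> `|\sum_(x in S) b x| <= #|S|%:R.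
Proof.
move=> hb; apply: le_trans (ler_norm_sum _ _ _) _.
by rewrite -sum1_card natr_sum; apply: ler_sum => x _; exact: hb.
Qed.

(* 1380/7 = (69/10)/(1 - 193/200): each partial colouring leaves at most 3/4 of
   the set uncoloured, so the bounds form a geometric series of ratio 193/200. *)
Lemma full_coloring (T J : finType) (a : J -> T -> R) (N : nat) (S : {set T}) :
  (forall j x, `|a j x| <= 1) -> (#|J| <= 2 * N)%nat -> (#|S| <= N)%nat ->
  exists U : {set T}, U \subset S /\ forall j,
    `|\sum_(x in U) a j x - \sum_(x in S :\: U) a j x| <=
      1380 / 7 * Num.sqrt N%:R * root8 (#|S|%:R / N%:R) + 1024.
Proof.
move=> ha leJ; have [m] := ubnP #|S|; elim: m S => // m IHm S; rewrite ltnS => leSm leSN.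
have [lt|ge] := ltnP #|S| 1024.
  (* With fewer than 1024 points every point gets +1; this is the additive 1024 of the bound. *)
  exists S; split=> // j; rewrite setDv big_set0 subr0.
  apply: le_trans (norm_sum_le_card _ (ha j)) _.
  have : #|S|%:R <= 1024 :> R by rewrite (ler_nat _ _ 1024) ltnW.
  have : 0 <= 1380 / 7 * Num.sqrt N%:R * root8 (#|S|%:R / N%:R) :> R.
    by rewrite !mulr_ge0 ?sqrtr_ge0 ?invr_ge0 ?ler0n.
  by lra.
have [U0 [V0 [sU sV UV big bound]]] := partial_coloring ha leJ leSN ge.
pose S' := S :\: (U0 :|: V0).
have sUV : U0 :|: V0 \subset S by rewrite subUset sU.
have cS' : (#|S'| + #|U0 :|: V0| = #|S|)%nat.
  by rewrite cardsD (setIidPr sUV) subnK // subset_leq_card.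
have lt' : (#|S'| < m)%nat.
  by apply: leq_trans leSm; rewrite -cS' -addn1 leq_add2l; lia.
have le' : (#|S'| <= N)%nat by apply: leq_trans leSN; rewrite -cS' leq_addr.
have [U' [sU' bound']] := IHm S' lt' le'.
(* The +1 points come from the partial colouring and from the recursive colouring of the uncoloured
   rest [S']. *)
exists (U0 :|: U'); split.
  by rewrite subUset sU (subset_trans sU') // subsetDl.
move=> j.
have E1 : \sum_(x in U0 :|: U') a j x = \sum_(x in U0) a j x + \sum_(x in U') a j x.
  rewrite big_mkcond [X in _ = X + _]big_mkcond [X in _ = _ + X]big_mkcond /= -big_split /=.
  apply: eq_bigr => x _; rewrite inE; have := subsetP sU' x; rewrite !inE.
  by case: (x \in U0); case: (x \in U') => //= h; rewrite ?addr0 ?add0r //; have := h isT.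
have E2 : \sum_(x in S :\: (U0 :|: U')) a j x =
    \sum_(x in V0) a j x + \sum_(x in S' :\: U') a j x.
  rewrite big_mkcond [X in _ = X + _]big_mkcond [X in _ = _ + X]big_mkcond /= -big_split /=.
  apply: eq_bigr => x _; rewrite !inE; have := subsetP sU' x; have := subsetP sV x.
  have := pred0P UV x; rewrite /= !inE.
  case: (x \in U0); case: (x \in V0); case: (x \in S); case: (x \in U') => //= h h1 h2;
    rewrite ?addr0 ?add0r //; by [have := h1 isT | have := h2 isT | have := h].
rewrite E1 E2.
have -> : \sum_(x in U0) a j x + \sum_(x in U') a j x -
    (\sum_(x in V0) a j x + \sum_(x in S' :\: U') a j x) =
  (\sum_(x in U0) a j x - \sum_(x in V0) a j x) +
  (\sum_(x in U') a j x - \sum_(x in S' :\: U') a j x) by ring.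
apply: le_trans (ler_normD _ _) _.
have : root8 (#|S'|%:R / N%:R) <= 193 / 200 * root8 (#|S|%:R / N%:R).
  apply: root8_contract; first by rewrite divr_ge0 ?ler0n.
  rewrite mulrA ler_wpM2r ?invr_ge0 ?ler0n //.
  have : (4 * #|S'| <= 3 * #|S|)%nat by lia.
  by rewrite -(ler_nat R) !natrM; lra.
move=> /(ler_wpM2l (sqrtr_ge0 (N%:R : R))).
have := bound j; have := bound' j; rewrite -!mulrA.
move: (`| _ |) => x; move: (`| _ |) => y.
rewrite !(mulrCA (Num.sqrt _)).
move: (Num.sqrt _ * root8 _) => z; move: (Num.sqrt _ * root8 _) => z'.
by lra.
Qed.

(** * Rounding a function with values in [0, 1] to a set of prescribed size *)

Section Rounding.
Variables (T J : finType) (a : J -> T -> R).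
Hypothesis a_le1 : forall j x, `|a j x| <= 1.

(** Induction on the number of binary digits. Colour the points with odd numerator, then round +1
    points up and -1 points down: all numerators become even. Removing the last of t + 1 digits
    costs D/2^(t+1), and these costs add up to less than D. *)
Lemma round_dyadic (D : R) (t : nat) (k : T -> nat) :
  (forall S : {set T}, exists U : {set T}, U \subset S /\ forall j,
    `|\sum_(x in U) a j x - \sum_(x in S :\: U) a j x| <= D) ->
  (forall x, (k x <= expn 2 t)%nat) ->
  exists A : {set T}, forall j,
    `|\sum_(x in A) a j x - \sum_x (k x)%:R / 2 ^+ t * a j x| <= (1 - (2 ^+ t)^-1) * D.
Proof.
move=> disc; elim: t k => [|t IHt] k k_le.
  exists [set x | k x == 1%nat] => j.
  rewrite expr0 invr1 subrr mul0r normr_le0 subr_eq0; apply/eqP.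
  rewrite big_mkcond; apply: eq_bigr => x _; rewrite inE.
  have := k_le x; rewrite expn0; case: (k x) => [|[|//]] _ /=.
    by rewrite !mul0r.
  by rewrite mulr1 mul1r.
have [U [sU bound]] := disc [set x | odd (k x)].
pose k' x := if x \in U then (k x).+1./2 else (k x)./2.
have k'_le x : (k' x <= expn 2 t)%nat.
  have := k_le x; rewrite expnS /k'; case: ifP => [/(subsetP sU)|_]; last by lia.
  by rewrite inE; lia.
have [A Abound] := IHt k' k'_le; exists A => j.
have pw0 : (2 ^+ t : R) != 0 by rewrite expf_neq0 // pnatr_eq0.
have E : \sum_x (k' x)%:R / 2 ^+ t * a j x - \sum_x (k x)%:R / 2 ^+ t.+1 * a j x =
    (2 ^+ t.+1)^-1 * (\sum_(x in U) a j x - \sum_(x in [set x | odd (k x)] :\: U) a j x).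
  rewrite [\sum_(x in U) _]big_mkcond [X in _ - X]big_mkcond [X in _ = _ * (_ - X)]big_mkcond /=.
  rewrite -!sumrB big_distrr /=; apply: eq_bigr => x _; rewrite !inE /k'.
  have kE : (k x)%:R = (odd (k x))%:R + 2 * ((k x)./2)%:R :> R.
    by rewrite -natrM -natrD mul2n odd_double_half.
  have := subsetP sU x; rewrite inE; case: (x \in U) => [/(_ isT) o|_] /=.
    have -> : uphalf (k x) = (k x)./2.+1 by lia.
    by rewrite kE o /= -natr1 exprS; field.
  rewrite kE exprS; case: (odd _) => /=; by field.
apply: (@le_trans _ _ ((1 - (2 ^+ t)^-1) * D + (2 ^+ t.+1)^-1 * D)).
  rewrite -(subrK (\sum_x (k' x)%:R / 2 ^+ t * a j x) (\sum_(x in A) a j x)) -addrA E.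
  apply: le_trans (ler_normD _ _) _; apply: lerD => //.
  rewrite normrM ger0_norm ?invr_ge0 ?exprn_ge0 //.
  by rewrite ler_wpM2l // invr_ge0 exprn_ge0.
by rewrite le_eqVlt; apply/orP; left; apply/eqP; rewrite exprS; field.
Qed.

Lemma round_function (D : R) (f : T -> R) :
  (forall S : {set T}, exists U : {set T}, U \subset S /\ forall j,
    `|\sum_(x in U) a j x - \sum_(x in S :\: U) a j x| <= D) ->
  0 <= D -> (forall x, 0 <= f x <= 1) ->
  exists A : {set T}, forall j,
    `|\sum_(x in A) a j x - \sum_x f x * a j x| <= D + 1.
Proof.
(* With t = |T| digits, truncation costs at most |T|/2^t <= 1 in each row. *)
move=> disc D0 f01; pose t := #|T|; pose k x := Num.trunc (2 ^+ t * f x).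
have p0 : 0 < (2 ^+ t : R) by rewrite exprn_gt0.
have g0 x : 0 <= 2 ^+ t * f x by have /andP[? _] := f01 x; rewrite mulr_ge0 // ltW.
have k_le x : (k x <= expn 2 t)%nat.
  rewrite -(ler_nat R) natrX; apply: le_trans (_ : 2 ^+ t * f x <= _).
    by rewrite truncn_le.
  by have /andP[_ f1] := f01 x; rewrite -[leRHS]mulr1 ler_pM2l.
have [A Abound] := round_dyadic disc k_le; exists A => j.
rewrite -(subrK (\sum_x (k x)%:R / 2 ^+ t * a j x) (\sum_(x in A) a j x)) -addrA.
apply: le_trans (ler_normD _ _) _; apply: lerD.
  apply: le_trans (Abound j) _; rewrite mulrBl mul1r gerBl.
  by rewrite mulr_ge0 // invr_ge0 ltW.
rewrite -sumrB; apply: le_trans (ler_norm_sum _ _ _) _.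
apply: (@le_trans _ _ (\sum_(x : T) (2 ^+ t)^-1)).
  apply: ler_sum => x _; rewrite -mulrBl normrM -[leRHS]mulr1.
  apply: ler_pM => //; have /andP[k1 k2] := truncn_itv (g0 x).
  rewrite -(ler_pM2l p0) mulfV ?gt_eqF // -[X in X * _]gtr0_norm // -normrM.
  rewrite mulrBr mulrCA mulfV ?gt_eqF // mulr1 -/(k x) distrC.
  by rewrite ger0_norm ?subr_ge0 // lerBlDl; apply: ltW; rewrite natr1.
rewrite sumr_const -[leLHS]mulr_natl ler_pdivrMr // mul1r -natrX ler_nat.
by apply: ltnW; apply: ltn_expl.
Qed.

Lemma exists_subset_card (B : {set T}) (m : nat) : (m <= #|B|)%nat ->
  exists C : {set T}, C \subset B /\ #|C| = m.
Proof.
move=> le; exists [set x in take m (enum B)]; split.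
  by apply/subsetP => x; rewrite inE => /mem_take; rewrite mem_enum.
have /card_uniqP eq : uniq (take m (enum B)) by rewrite take_uniq // enum_uniq.
by rewrite cardsE eq size_takel // -cardE.
Qed.

Lemma adjust_card (A : {set T}) (m : nat) : (m <= #|T|)%nat ->
  exists A' : {set T}, #|A'| = m /\ forall j,
    `|\sum_(x in A') a j x - \sum_(x in A) a j x| <= `|#|A|%:R - m%:R|.
Proof.
move=> le; have [mA|Am] := leqP m #|A|.
  have [C [sC cC]] := exists_subset_card mA; exists C; split=> // j.
  rewrite distrC (big_setID C) /= (setIidPr sC) addrAC subrr add0r.
  apply: le_trans (norm_sum_le_card _ (a_le1 j)) _.
  by rewrite cardsD (setIidPr sC) cC natrB // ler_norm.
have : (m - #|A| <= #|~: A|)%nat by have := cardsC A; lia.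
case/exists_subset_card => C [sC cC]; exists (A :|: C).
have dis : [disjoint A & C] by rewrite disjoint_sym disjoints_subset.
split; first by rewrite cardsU (disjoint_setI0 dis) cards0 cC; lia.
move=> j; rewrite (big_setID A) /= setUK setDUl setDv set0U addrAC subrr add0r.
apply: le_trans (norm_sum_le_card _ (a_le1 j)) _.
rewrite distrC -natrB 1?ltnW // normr_nat ler_nat -cC.
exact: subset_leq_card (subsetDl _ _).
Qed.

(** The constant row [j0] records cardinality, so rounding with error D + 1 leaves |A| within D + 2
    of [m]. Correcting the size costs at most D + 2 more, and 2D + 3 is the stated bound. *)
Lemma round_with_card (N : nat) (f : T -> R) (m : nat) (j0 : J) :
  (#|J| <= 2 * N)%nat -> (#|T| <= N)%nat -> (forall x, a j0 x = 1) ->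
  (forall x, 0 <= f x <= 1) -> (m <= #|T|)%nat -> `|\sum_x f x - m%:R| <= 1 ->
  exists A : {set T}, #|A| = m /\ forall j,
    `|\sum_(x in A) a j x - \sum_x f x * a j x| <= 2760 / 7 * Num.sqrt N%:R + 2051.
Proof.
move=> leJ leT a1 f01 mT fm.
pose D : R := 1380 / 7 * Num.sqrt N%:R + 1024.
have D0 : 0 <= D by rewrite addr_ge0 ?mulr_ge0 ?sqrtr_ge0 ?invr_ge0 ?ler0n.
have disc (S : {set T}) : exists U : {set T}, U \subset S /\ forall j,
    `|\sum_(x in U) a j x - \sum_(x in S :\: U) a j x| <= D.
  have leS : (#|S| <= N)%nat by apply: leq_trans leT; exact: max_card.
  have [U [sU bound]] := full_coloring a_le1 leJ leS; exists U; split=> // j.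
  apply: le_trans (bound j) _; rewrite lerD2r -[leRHS]mulr1 ler_wpM2l //.
    by rewrite mulr_ge0 ?sqrtr_ge0 ?divr_ge0 ?ler0n.
  rewrite -[leRHS](@root8_pow8 1) // expr1n; apply: ler_root8.
  (* For N = 0 the quotient is 0, because the inverse of 0 is 0. *)
  have [->|N0] := posnP N; first by rewrite invr0 mulr0.
  by rewrite ler_pdivrMr ?ltr0n // mul1r ler_nat.
have [A Abound] := round_function disc D0 f01.
have [A' [cA' A'bound]] := adjust_card A mT; exists A'; split=> // j.
have cA : `|#|A|%:R - m%:R| <= D + 2.
  have := Abound j0.
  rewrite (eq_bigr (fun => 1)) => [|x _]; last exact: a1.
  rewrite sumr_const (eq_bigr f) => [h|x _]; last by rewrite a1 mulr1.
  rewrite -(subrK (\sum_x f x) #|A|%:R) -addrA; apply: le_trans (ler_normD _ _) _.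
  by move: h fm; lra.
rewrite -(subrK (\sum_(x in A) a j x) (\sum_(x in A') a j x)) -addrA.
apply: le_trans (ler_normD _ _) _.
by have := Abound j; have := A'bound j; rewrite /D in cA *; lra.
Qed.

End Rounding.
(** * Characters and the Riesz product *)

Definition omega (N : nat) : R[i] := Complex (cos (2 * PI / N%:R)) (sin (2 * PI / N%:R)).

(** The character e(z/N), with integer argument so that signed relations can be inserted without
    reduction modulo [N]. *)
Definition chi (N : nat) (z : int) : R[i] := omega N ^ z.

Section Character.
Variable N : nat.
Hypothesis N_gt0 : (0 < N)%nat.

Let NR0 : (N%:R : R) != 0. Proof. by rewrite pnatr_eq0 -lt0n. Qed.

Lemma omegaX (k : nat) :
  omega N ^+ k = Complex (cos (2 * PI * k%:R / N%:R)) (sin (2 * PI * k%:R / N%:R)).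
Proof.
elim: k => [|k IHk]; first by rewrite mulr0 mul0r cos_0 sin_0.
rewrite exprS IHk /omega.
have -> : 2 * PI * k.+1%:R / N%:R = 2 * PI / N%:R + 2 * PI * k%:R / N%:R :> R.
  by rewrite -natr1; field.
rewrite cosD sinD; apply/eqP; rewrite eq_complex /=.
by apply/andP; split; apply/eqP; ring.
Qed.

Lemma omegaXN : omega N ^+ N = 1.
Proof. by rewrite omegaX mulfK // cos_2PI sin_2PI. Qed.

Lemma omega_unit : omega N \is a GRing.unit.
Proof.
rewrite unitfE; apply/eqP => w0; have := omegaXN.
by rewrite w0 expr0n eqn0Ngt N_gt0 mulr0n => /esym/eqP; rewrite oner_eq0.
Qed.

Lemma chiD (y z : int) : chi N (y + z) = chi N y * chi N z.
Proof. by rewrite /chi exprzDr // omega_unit. Qed.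

Lemma chi0 : chi N 0 = 1. Proof. exact: expr0z. Qed.

Lemma chi_sum (I : Type) (r : seq I) (P : pred I) (F : I -> int) :
  chi N (\sum_(i <- r | P i) F i) = \prod_(i <- r | P i) chi N (F i).
Proof. by apply: (big_morph (chi N) chiD chi0). Qed.

Lemma chiM (y : int) (k : nat) : chi N (y * k%:Z) = chi N y ^+ k.
Proof. by rewrite /chi [RHS]exprnP exprz_exp. Qed.

Lemma chi_nat (k : nat) :
  chi N k%:Z = Complex (cos (2 * PI * k%:R / N%:R)) (sin (2 * PI * k%:R / N%:R)).
Proof. exact: omegaX. Qed.

Lemma chi_add_opp_nat (k : nat) :
  chi N k%:Z + chi N (- k%:Z) = Complex (2 * cos (2 * PI * k%:R / N%:R)) 0.
Proof.
have nE : chi N (- k%:Z) = Complex (cos (2 * PI * k%:R / N%:R)) (- sin (2 * PI * k%:R / N%:R)).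
  apply: (mulrI (x := chi N k%:Z)); first by rewrite unitrX // omega_unit.
  rewrite -chiD subrr chi0 chi_nat; apply/eqP; rewrite eq_complex /=.
  have := sin2_cos2 (2 * PI * k%:R / N%:R); rewrite /Rsqr => h.
  apply/andP; split; apply/eqP; last by ring.
  by rewrite mulrN opprK addrC; exact: esym h.
rewrite nE chi_nat; apply/eqP; rewrite eq_complex /= subrr eqxx andbT.
by apply/eqP; ring.
Qed.

Lemma chi_dvd (z : int) : (z \in dvdz N) -> chi N z = 1.
Proof.
case/dvdzP => q ->; rewrite chiM /chi exprnP exprz_exp mulrC -exprz_exp -exprnP.
by rewrite omegaXN exp1rz.
Qed.

Lemma cos_lt1 (t : R) : 0 < t -> t < 2 * PI -> cos t < 1.
Proof.
move=> t0 tp; have s0 : 0 < sin (t / 2).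
  have h1 : 0 < t / 2 by lra.
  have h2 : t / 2 < PI by lra.
  by apply/RltP/sin_gt_0; apply/RltP.
have -> : t = t / 2 + t / 2 by field.
rewrite cosD; have := sin2_cos2 (t / 2); rewrite /Rsqr => h.
have {}h : sin (t / 2) * sin (t / 2) + cos (t / 2) * cos (t / 2) = 1 := h.
nra.
Qed.

(** After reducing z modulo [N] to some 0 <= k < N, the real part cos(2 pi k/N) is 1 only for k =
    0. *)
Lemma chi_eq1 (z : int) : chi N z = 1 -> (z \in dvdz N).
Proof.
have NZ0 : N%:Z != 0 by move: N_gt0; case: N.
rewrite {1}(divz_eq z N) chiD chi_dvd ?mul1r ?dvdz_mull // => h.
have m0 := modz_ge0 z NZ0; have mN : modz z N < N%:Z by apply: ltz_pmod; rewrite ltz_nat.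
apply/dvdz_mod0P; move: m0 mN h; case: (modz z N) => // k _.
rewrite ltz_nat => kN; rewrite chi_nat => -[/eqP ck _].
have [->//|k0] := posnP k.
exfalso; move: ck; rewrite lt_eqF // cos_lt1 //.
  by rewrite divr_gt0 ?ltr0n // mulr_gt0 ?ltr0n // mulr_gt0 ?ltr0n //; apply/RltP/PI_RGT_0.
rewrite ltr_pdivrMr ?ltr0n // ltr_pM2l ?ltr_nat //.
by rewrite mulr_gt0 ?ltr0n //; apply/RltP/PI_RGT_0.
Qed.

(** Orthogonality: if [N] does not divide z, multiplying the geometric sum by the nonzero chi(z) - 1
    gives chi(zN) - 1 = 0. *)
Lemma sum_chi (z : int) :
  \sum_(x < N) chi N (z * x%:Z) = if (z \in dvdz N) then N%:R else 0.
Proof.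
under eq_bigr do rewrite chiM.
case: ifPn => [/chi_dvd ->|ndvd].
  by under eq_bigr do rewrite expr1n; rewrite sumr_const card_ord.
apply: (mulfI (x := chi N z - 1)).
  by rewrite subr_eq0; apply: contra ndvd => /eqP/chi_eq1.
by rewrite mulr0 -subrX1 -chiM chi_dvd ?subrr // dvdz_mull.
Qed.

End Character.

(** * The Riesz factor of a single block and its expansion *)

Section Blocks.
Variables (N : nat) (a : R).
Hypothesis N_gt0 : (0 < N)%nat.

(** The perturbation of 1 is imaginary, so a factor has squared modulus at most 1 + a^2 rather than
    modulus up to 1 + a; this permits blocks of about a^-2 frequencies. *)
Definition block_prod (P : {set 'I_N}) (x : 'I_N) : R[i] :=
  \prod_(l in P) Complex 1 (a * cos (2 * PI * (x * l)%:R / N%:R)).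

Definition block_fun (P : {set 'I_N}) (x : 'I_N) : R :=
  1 + complex.Im (block_prod P x) / 2.

Definition normsq (z : R[i]) : R := complex.Re z ^+ 2 + complex.Im z ^+ 2.

Lemma normsqM (y z : R[i]) : normsq (y * z) = normsq y * normsq z.
Proof. by case: y => y1 y2; case: z => z1 z2; rewrite /normsq /=; ring. Qed.

(** The hypothesis bounds the modulus of [block_prod] by 2, so its imaginary part lies in
    [-2, 2]. *)
Lemma block_fun_bounds (P : {set 'I_N}) (x : 'I_N) :
  (1 + a ^+ 2) ^+ #|P| <= 4 -> 0 <= block_fun P x <= 2.
Proof.
move=> le4.
have : normsq (block_prod P x) <= 4.
  apply: le_trans le4; rewrite /block_prod (big_morph normsq normsqM (id1 := 1)).
    rewrite -prodr_const; apply: ler_prod => l _; rewrite /normsq /=.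
    have := sin2_cos2 (2 * PI * (x * l)%:R / N%:R); rewrite /Rsqr.
    move: (sin _) (cos _) => u v h; have {}h : u * u + v * v = 1 := h.
    have h1 := sqr_ge0 (a * u); have h2 := sqr_ge0 (a * v).
    have : a ^+ 2 = (a * u) ^+ 2 + (a * v) ^+ 2.
      have -> : (a * u) ^+ 2 + (a * v) ^+ 2 = a ^+ 2 * (u * u + v * v) by ring.
      by rewrite h mulr1.
    by move=> e; apply/andP; split; lra.
  by rewrite /normsq /=; ring.
rewrite /normsq /block_fun; have := sqr_ge0 (complex.Re (block_prod P x)).
move: (complex.Re _) (complex.Im _) => u v; nra.
Qed.

(* The digits 0, 1, 2 of s : 'I_N -> 'I_3 encode the coefficients -1, 0, 1 of a relation. *)
Definition coeff (t : 'I_3) : int := t%:Z - 1.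

Definition rel_sum (s : {ffun 'I_N -> 'I_3}) : int := \sum_(l < N) coeff (s l) * l%:Z.

Definition rel_supp (s : {ffun 'I_N -> 'I_3}) : {set 'I_N} := [set l | coeff (s l) != 0].

Lemma prod_rel_expand (P : {set 'I_N}) (b : R[i]) (x : 'I_N) :
  \prod_(l in P) (1 + b * (chi N (x * l)%:Z + chi N (- (x * l)%:Z))) =
  \sum_(s : {ffun 'I_N -> 'I_3} | rel_supp s \subset P)
    b ^+ #|rel_supp s| * chi N (rel_sum s * x%:Z).
Proof.
(* Off [P] a nonzero digit gets weight 0, so the product may run over all of Z_N and the
   distributive law sums over all digit functions. *)
pose u (l : 'I_N) (t : 'I_3) : R[i] := if coeff t == 0 then 1 else
  if l \in P then b * chi N (coeff t * l%:Z * x%:Z) else 0.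
rewrite big_mkcond (eq_bigr (fun l => \sum_t u l t)) /=; last first.
  move=> l _; rewrite !big_ord_recl big_ord0 /u /coeff /= !addr0.
  case: (l \in P); last by rewrite add0r addr0.
  rewrite addrCA; congr (_ + _); rewrite -mulrDr addrC; congr (_ * (_ + _)).
    by rewrite -[_ - 1]/(-1 : int) PoszM; congr chi; ring.
  by rewrite -[_ - 1]/(1 : int) PoszM; congr chi; ring.
rewrite bigA_distr_bigA [RHS]big_mkcond; apply: eq_bigr => s _.
case: ifPn => [/subsetP sP|/subsetPn[l ls lP]]; last first.
  by rewrite (bigD1 l) //= /u; move: ls; rewrite inE => /negPf ->; rewrite (negPf lP) mul0r.
rewrite (eq_bigr (fun l => (if l \in rel_supp s then b else 1) *
    chi N (coeff (s l) * l%:Z * x%:Z))).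
  rewrite big_split /= -chi_sum // -big_distrl /=; congr (_ * _).
  by rewrite -big_mkcond /= prodr_const.
move=> l _; rewrite /u; have := sP l; rewrite inE; case: eqP => [->|_ /(_ isT) ->] //=.
by rewrite !mul0r chi0 mulr1.
Qed.

(** The coefficient of the choice [s] in [block_fun]: Im(z)/2 = (z - conj z)/(4i), and conjugation
    turns [a] into [- a]. Supports of even size cancel in the second summand. *)
Definition block_coeff (P : {set 'I_N}) (s : {ffun 'I_N -> 'I_3}) : R[i] :=
  (if rel_supp s == set0 then 1 else 0) +
  (if rel_supp s \subset P then
    (Complex 0 (a / 2) ^+ #|rel_supp s| - Complex 0 (- (a / 2)) ^+ #|rel_supp s|) /
    Complex 0 4 else 0).

Lemma rel_supp0 (s : {ffun 'I_N -> 'I_3}) :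
  (rel_supp s == set0) = (s == [ffun => Ordinal (isT : (1 < 3)%nat)]).
Proof.
apply/eqP/eqP => [e|->]; last by apply/setP => l; rewrite !inE ffunE.
apply/ffunP => l; rewrite ffunE; apply/val_inj => /=.
have : l \notin rel_supp s by rewrite e inE.
by rewrite inE negbK; case: (s l) => -[|[|[|m]]].
Qed.

Lemma block_fun_expand (P : {set 'I_N}) (x : 'I_N) :
  Complex (block_fun P x) 0 =
  \sum_(s : {ffun 'I_N -> 'I_3}) block_coeff P s * chi N (rel_sum s * x%:Z).
Proof.
rewrite /block_coeff; under [RHS]eq_bigr do rewrite mulrDl.
rewrite big_split /=.
have -> : \sum_(s : {ffun 'I_N -> 'I_3})
    (if rel_supp s == set0 then 1 else 0) * chi N (rel_sum s * x%:Z) = 1.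
  rewrite (bigD1 [ffun => Ordinal (isT : (1 < 3)%nat)]) //= [X in _ + X]big1.
    rewrite rel_supp0 eqxx mul1r addr0 /rel_sum big1 ?mul0r ?chi0 // => l _.
    by rewrite ffunE mul0r.
  by move=> s /negPf; rewrite -rel_supp0 => ->; rewrite mul0r.
have expand (c : R) : \prod_(l in P) Complex 1 (c * cos (2 * PI * (x * l)%:R / N%:R)) =
    \sum_(s : {ffun 'I_N -> 'I_3} | rel_supp s \subset P)
      Complex 0 (c / 2) ^+ #|rel_supp s| * chi N (rel_sum s * x%:Z).
  rewrite -prod_rel_expand; apply: eq_bigr => l _.
  rewrite chi_add_opp_nat //; apply/eqP; rewrite eq_complex /=.
  by apply/andP; split; apply/eqP; field.
have -> : \sum_(s : {ffun 'I_N -> 'I_3}) (if rel_supp s \subset P then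
    (Complex 0 (a / 2) ^+ #|rel_supp s| - Complex 0 (- (a / 2)) ^+ #|rel_supp s|) /
    Complex 0 4 else 0) * chi N (rel_sum s * x%:Z) =
    (block_prod P x - (block_prod P x)^*%C) / Complex 0 4.
  have -> : (block_prod P x)^*%C =
      \prod_(l in P) Complex 1 (- a * cos (2 * PI * (x * l)%:R / N%:R)).
    rewrite /block_prod rmorph_prod; apply: eq_bigr => l _.
    by apply/eqP; rewrite eq_complex /= mulNr !eqxx.
  rewrite /block_prod !expand -sumrB mulr_suml [RHS]big_mkcond /=.
  apply: eq_bigr => s _; case: ifP => _; last by rewrite mul0r.
  by rewrite mulNr -mulrBl mulrAC.
rewrite /block_fun; case: (block_prod P x) => u v.
by apply/eqP; rewrite eq_complex /=; apply/andP; split; apply/eqP; field.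
Qed.

End Blocks.

(** * Moduli of the expansion coefficients *)

Lemma normc_prod (I : Type) (r : seq I) (P : pred I) (F : I -> R[i]) :
  Normc.normc (\prod_(i <- r | P i) F i) = \prod_(i <- r | P i) Normc.normc (F i).
Proof.
exact: (big_morph (@Normc.normc R) (@Normc.normcM R) (Normc.normc1 R)).
Qed.

Lemma normcX (z : R[i]) (k : nat) : Normc.normc (z ^+ k) = Normc.normc z ^+ k.
Proof.
elim: k => [|k IHk]; first by rewrite !expr0 Normc.normc1.
by rewrite !exprS Normc.normcM IHk.
Qed.

Lemma normc_imag (b : R) : Normc.normc (Complex 0 b) = `|b|.
Proof. by rewrite /= expr0n add0r sqrtr_sqr. Qed.

Lemma normc_real (b : R) : Normc.normc (Complex b 0) = `|b|.
Proof. by rewrite /= expr0n addr0 sqrtr_sqr. Qed.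

Section BlockCoeff.
Variables (N : nat) (a : R) (P : {set 'I_N}).
Hypothesis a_ge0 : 0 <= a.

Lemma normc_block_coeff (s : {ffun 'I_N -> 'I_3}) :
  Normc.normc (block_coeff a P s) <= (a / 2) ^+ #|rel_supp s|.
Proof.
have a2 : 0 <= a / 2 by rewrite divr_ge0.
rewrite /block_coeff; case: eqP => [->|_].
  by rewrite sub0set cards0 !expr0 subrr mul0r addr0 Normc.normc1.
rewrite add0r; case: ifP => _; last by rewrite Normc.normc0 exprn_ge0.
rewrite Normc.normcM Normc.normcV normc_imag (ger0_norm (ler0n _ 4)).
rewrite ler_pdivrMr ?ltr0n //; apply: le_trans (le_normcD _ _) _.
rewrite normcN !normcX !normc_imag normrN (ger0_norm a2).
by have := exprn_ge0 #|rel_supp s| a2; lra.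
Qed.

Lemma block_coeff_null (s : {ffun 'I_N -> 'I_3}) :
  rel_supp s = set0 -> block_coeff a P s = 1.
Proof.
by move=> e; rewrite /block_coeff e eqxx sub0set cards0 !expr0 subrr mul0r addr0.
Qed.

Lemma block_coeff_single (s : {ffun 'I_N -> 'I_3}) (l : 'I_N) :
  l \in P -> rel_supp s = [set l] -> block_coeff a P s = Complex (a / 4) 0.
Proof.
move=> lP e; rewrite /block_coeff e sub1set lP cards1 !expr1.
have -> : ([set l] == set0) = false by apply/negbTE/set0Pn; exists l; rewrite inE.
by apply/eqP; rewrite eq_complex /=; apply/andP; split; apply/eqP; field.
Qed.

Lemma block_coeff_eq0 (s : {ffun 'I_N -> 'I_3}) :
  ~~ (rel_supp s \subset P) -> block_coeff a P s = 0.
Proof.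
move=> sP; rewrite /block_coeff (negPf sP) addr0 ifN //.
by apply: contra sP => /eqP ->; apply: sub0set.
Qed.

End BlockCoeff.

(** * Fourier transform of the full Riesz product *)

Section Spectrum.
Variables (N p : nat) (a : R) (P : 'I_p -> {set 'I_N}).
Hypothesis N_gt0 : (0 < N)%nat.
Hypothesis a_ge0 : 0 <= a.
Hypothesis P_disj : forall i j, i != j -> [disjoint P i & P j].
Hypothesis dissociated : forall c : 'I_N -> int,
  (forall i x, x \in P i -> (absz (c x) <= 2)%nat) ->
  \sum_(x in \bigcup_i P i) c x * x%:Z \in dvdz N ->
  forall i x, x \in P i -> c x = 0.

Local Notation family := {ffun 'I_p -> {ffun 'I_N -> 'I_3}}.

Definition riesz (x : 'I_N) : R := \prod_i block_fun a (P i) x.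

Definition riesz_hat (r : int) : R[i] := \sum_x Complex (riesz x) 0 * chi N (r * x%:Z).

Definition fam_sum (S : family) : int := \sum_i rel_sum (S i).

Definition fam_coeff (S : family) : R[i] := \prod_i block_coeff a (P i) (S i).

Definition fam_valid (S : family) : bool := [forall i, rel_supp (S i) \subset P i].

(** Expand every block; orthogonality keeps exactly the families whose total frequency cancels [r]
    modulo [N]. *)
Lemma riesz_hat_expand (r : int) :
  riesz_hat r = N%:R * \sum_(S : family | fam_sum S + r \in dvdz N) fam_coeff S.
Proof.
have expand x : Complex (riesz x) 0 =
    \sum_(S : family) fam_coeff S * chi N (fam_sum S * x%:Z).
  have -> : Complex (riesz x) 0 = \prod_i Complex (block_fun a (P i) x) 0.
    exact: (rmorph_prod (real_complex R)).
  under eq_bigr do rewrite block_fun_expand //.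
  rewrite bigA_distr_bigA; apply: eq_bigr => S _.
  by rewrite big_split /= -chi_sum // /fam_sum big_distrl.
rewrite /riesz_hat; under eq_bigr do rewrite expand mulr_suml.
rewrite exchange_big big_distrr [RHS]big_mkcond /=; apply: eq_bigr => S _.
under eq_bigr do rewrite -mulrA -chiD // -mulrDl.
by rewrite -big_distrr /= sum_chi //; case: ifP => _; rewrite ?mulr0 // mulrC.
Qed.

Lemma fam_coeff_eq0 (S : family) : ~~ fam_valid S -> fam_coeff S = 0.
Proof.
case/forallPn => i iP; rewrite /fam_coeff (bigD1 i) //=.
by rewrite block_coeff_eq0 // mul0r.
Qed.

Lemma valid_coeff0 (S : family) (i : 'I_p) (x : 'I_N) :
  fam_valid S -> x \notin P i -> coeff (S i x) = 0.
Proof.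
move/forallP/(_ i)/subsetP/(_ x) => h xP; apply/eqP.
by apply: contraNT xP => n0; apply: h; rewrite inE.
Qed.

Lemma fam_sumE (S : family) : fam_sum S = \sum_(x < N) (\sum_i coeff (S i x)) * x%:Z.
Proof.
rewrite /fam_sum /rel_sum exchange_big /=; apply: eq_bigr => x _.
by rewrite big_distrl.
Qed.

Lemma valid_coeff_sum (S : family) (i : 'I_p) (x : 'I_N) :
  fam_valid S -> x \in P i -> \sum_j coeff (S j x) = coeff (S i x).
Proof.
move=> vS xP; rewrite (bigD1 i) //= big1 ?addr0 // => j ji.
by apply: valid_coeff0 => //; rewrite (disjointFr (P_disj _) xP) // eq_sym.
Qed.

Lemma coeff_inj : injective coeff.
Proof. by move=> s t /addIr [] /val_inj. Qed.

(** Coefficients in {-1, 0, 1} differ by at most 2, so two valid families for the same [r] differ by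
    a relation to which [dissociated] applies; this is where its bound 2 comes from. *)
Lemma valid_unique (S S' : family) (r : int) : fam_valid S -> fam_valid S' ->
  fam_sum S + r \in dvdz N -> fam_sum S' + r \in dvdz N -> S = S'.
Proof.
move=> vS vS' dS dS'.
pose c x := \sum_i coeff (S i x) - \sum_i coeff (S' i x).
have cE i x : x \in P i -> c x = coeff (S i x) - coeff (S' i x).
  by move=> xP; rewrite /c !(valid_coeff_sum _ xP).
have c0 : forall i x, x \in P i -> c x = 0.
  apply: dissociated => [i x xP|].
    rewrite (cE _ _ xP) /coeff.
    by move: (S i x) (S' i x) => [[|[|[|k]]] //] ? [[|[|[|k']]] //].
  have -> : \sum_(x in \bigcup_i P i) c x * x%:Z = (fam_sum S + r) - (fam_sum S' + r).
    rewrite opprD addrACA subrr addr0 !fam_sumE -sumrB big_mkcond /=.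
    apply: eq_bigr => x _; rewrite -mulrBl; case: ifPn => // xL.
    rewrite !big1 ?subrr ?mul0r // => i _; apply: valid_coeff0 => //;
      by apply: contra xL => xP; apply/bigcupP; exists i.
  by rewrite rpredB.
apply/ffunP => i; apply/ffunP => x; apply: coeff_inj.
have [xP|xP] := boolP (x \in P i); last by rewrite !valid_coeff0.
by apply/eqP; rewrite -subr_eq0 -cE // (c0 i).
Qed.

Lemma riesz_hat_valid (S : family) (r : int) :
  fam_valid S -> fam_sum S + r \in dvdz N -> riesz_hat r = N%:R * fam_coeff S.
Proof.
move=> vS dS; rewrite riesz_hat_expand (bigD1 S) //= big1 ?addr0 // => S' /andP[dS' neq].
apply: fam_coeff_eq0; apply: contra neq => vS'; apply/eqP.
exact: (valid_unique vS' vS dS' dS).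
Qed.

Lemma normc_fam_coeff (S : family) :
  Normc.normc (fam_coeff S) <= (a / 2) ^+ (\sum_i #|rel_supp (S i)|).
Proof.
rewrite /fam_coeff normc_prod (big_morph _ (exprD (a / 2)) (expr0 _)).
apply: ler_prod => i _; rewrite normc_block_coeff // andbT.
by case: (block_coeff _ _ _) => u v; apply: sqrtr_ge0.
Qed.

Lemma rel_sum_supp (s : {ffun 'I_N -> 'I_3}) :
  rel_sum s = \sum_(l in rel_supp s) coeff (s l) * l%:Z.
Proof.
rewrite /rel_sum [RHS]big_mkcond /=; apply: eq_bigr => l _.
by rewrite inE; case: eqP => // ->; rewrite mul0r.
Qed.

Lemma riesz_hat0 : riesz_hat 0 = N%:R.
Proof.
pose S : family := [ffun => [ffun => Ordinal (isT : (1 < 3)%nat)]].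
have S0 i : rel_supp (S i) = set0 by apply/eqP; rewrite rel_supp0 ffunE.
rewrite (@riesz_hat_valid S).
- by rewrite /fam_coeff big1 ?mulr1 // => i _; apply: block_coeff_null.
- by apply/forallP => i; rewrite S0 sub0set.
by rewrite addr0 /fam_sum big1 ?dvdz0 // => i _; rewrite rel_sum_supp S0 big_set0.
Qed.

Lemma normc_riesz_hat_single (i : 'I_p) (l : 'I_N) (t : 'I_3) (r : int) :
  l \in P i -> coeff t != 0 -> coeff t * l%:Z + r \in dvdz N ->
  Normc.normc (riesz_hat r) = N%:R * (a / 4).
Proof.
move=> lP t0 dr; pose S : family := [ffun j => [ffun x =>
  if (j == i) && (x == l) then t else Ordinal (isT : (1 < 3)%nat)]].
have Si : rel_supp (S i) = [set l].
  by apply/setP => x; rewrite inE [in RHS]inE !ffunE eqxx; case: (x == l).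
have Sj j : j != i -> rel_supp (S j) = set0.
  by move=> /negPf ji; apply/setP => x; rewrite !inE !ffunE ji.
rewrite (@riesz_hat_valid S).
- rewrite /fam_coeff (bigD1 i) //= (block_coeff_single _ lP Si) big1 ?mulr1.
    rewrite Normc.normcM -[N%:R : R[i]](rmorph_nat (real_complex R)) !normc_real.
    by rewrite normr_nat ger0_norm // divr_ge0.
  by move=> j /Sj e; apply: block_coeff_null.
- apply/forallP => j; have [->|/Sj ->] := eqVneq j i; last exact: sub0set.
  by rewrite Si sub1set.
rewrite /fam_sum (bigD1 i) //= big1 ?addr0 => [|j /Sj e].
  by rewrite rel_sum_supp Si big_set1 !ffunE !eqxx.
by rewrite rel_sum_supp e big_set0.
Qed.

(** A valid family representing -r has total support at least 2: an empty support would make [N]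
    divide r, a single frequency l would make r congruent to l or -l. If there is no such family,
    the transform vanishes. *)
Lemma normc_riesz_hat_small (r : int) : a / 2 <= 1 -> r \notin dvdz N ->
  (forall i l, l \in P i -> (r - l%:Z \notin dvdz N) && (r + l%:Z \notin dvdz N)) ->
  Normc.normc (riesz_hat r) <= N%:R * (a / 2) ^+ 2.
Proof.
move=> a_le r0 rP; have a2 : 0 <= a / 2 by rewrite divr_ge0.
have [/existsP[S /andP[vS dS]]|none] :=
  boolP [exists S : family, fam_valid S && (fam_sum S + r \in dvdz N)]; last first.
  rewrite riesz_hat_expand big1 => [|S dS].
    by rewrite mulr0 Normc.normc0 mulr_ge0 ?exprn_ge0.
  apply: fam_coeff_eq0; apply: contra none => vS.
  by apply/existsP; exists S; rewrite vS.
rewrite (riesz_hat_valid vS dS) Normc.normcM.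
rewrite -[N%:R : R[i]](rmorph_nat (real_complex R)) normc_real normr_nat.
rewrite ler_wpM2l //; apply: le_trans (normc_fam_coeff S) _.
suff : (2 <= \sum_i #|rel_supp (S i)|)%nat by move=> ?; apply: ler_wiXn2l.
have supp0 i : #|rel_supp (S i)| = 0%nat -> rel_sum (S i) = 0.
  by move/cards0_eq => e; rewrite rel_sum_supp e big_set0.
rewrite ltnNge; apply/negP => le1.
have [/existsP[i i0]|all0] := boolP [exists i, rel_supp (S i) != set0]; last first.
  move: dS; rewrite /fam_sum big1 ?add0r ?(negPf r0) // => i _; apply: supp0.
  by apply/eqP; rewrite cards_eq0; apply: contraNT all0 => n0; apply/existsP; exists i.
have {le1} : (#|rel_supp (S i)| + \sum_(j | j != i) #|rel_supp (S j)| <= 1)%nat.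
  by move: le1; rewrite (bigD1 i).
rewrite -cards_eq0 -lt0n in i0.
move=> le1; have [card1 sum0] : #|rel_supp (S i)| = 1%nat /\
  (\sum_(j | j != i) #|rel_supp (S j)| = 0)%nat by lia.
move/eqP: card1 => /cards1P[l Sl].
move/eqP: sum0; rewrite sum_nat_eq0 => /forall_inP sum0.
have lP : l \in P i by have /forallP/(_ i) := vS; rewrite Sl sub1set.
have : coeff (S i l) != 0 by have := set11 l; rewrite -Sl inE.
have /andP[rm rp] := rP i l lP.
move: dS; rewrite /fam_sum (bigD1 i) //= big1 => [|j ji]; last first.
  by apply: supp0; apply/eqP; apply: sum0.
rewrite addr0 rel_sum_supp Sl big_set1 /coeff.
(* Digit 0 gives r - l and digit 2 gives r + l; digit 1 contradicts the nonzero coefficient. *)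
case: (S i l) => -[|[|[|k]]] // lt3 /=.
  by rewrite [_ - 1]/(-1 : int) mulN1r addrC (negPf rm).
by rewrite [_ - 1]/(1 : int) mul1r addrC (negPf rp).
Qed.

Lemma riesz_hat_nat (k : nat) :
  riesz_hat k%:Z = Complex (\sum_x riesz x * cos (2 * PI * (x * k)%:R / N%:R))
    (\sum_x riesz x * sin (2 * PI * (x * k)%:R / N%:R)).
Proof.
rewrite /riesz_hat; apply: (big_rec3 (fun z u v => z = Complex u v)) => //.
move=> x z u v _ ->; rewrite -PoszM chi_nat // mulnC.
by apply/eqP; rewrite eq_complex /= !mul0r subr0 addr0 !eqxx.
Qed.

Lemma riesz_bounds : (forall i, (1 + a ^+ 2) ^+ #|P i| <= 4) ->
  forall x, 0 <= riesz x <= 2 ^+ p.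
Proof.
move=> le4 x; rewrite /riesz; apply/andP; split.
  by apply: prodr_ge0 => i _; have /andP[] := block_fun_bounds x (le4 i).
rewrite -[p in leRHS]card_ord -prodr_const; apply: ler_prod => i _.
exact: block_fun_bounds.
Qed.

End Spectrum.
(** * Realizing the spectrum *)

Lemma negZN_dvd (N : nat) (r l : 'I_N) :
  (r%:Z + l%:Z \in dvdz N) = (r == negZN l).
Proof.
rewrite -PoszD; change ((N %| r + l)%nat = (r == negZN l)).
have rN := ltn_ord r; have lN := ltn_ord l.
have -> : (r == negZN l) = (nat_of_ord r == (N - l) %% N)%nat by [].
have [l0|l0] := posnP l.
  rewrite l0 addn0 subn0 modnn; have [->|r0] := posnP r; first by rewrite dvdn0.
  by rewrite gtnNdvd // gtn_eqF.
rewrite modn_small; last by lia.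
apply/dvdnP/eqP => [[q e]|->]; last by exists 1%nat; lia.
by case: q e => [|[|q]]; nia.
Qed.

Lemma sub_ord_dvd (N : nat) (r l : 'I_N) : (r%:Z - l%:Z \in dvdz N) = (r == l).
Proof.
have -> : (r%:Z - l%:Z \in dvdz N) = (modz r N == modz l N) by rewrite eqz_mod_dvd.
by rewrite !modz_nat eqz_nat !modn_small.
Qed.

Lemma fourier_normc (N : nat) (A : {set 'I_N}) (r : 'I_N) :
  fourier_abs A r = Normc.normc (Complex
    (\sum_(x in A) cos (2 * PI * (x * r)%:R / N%:R))
    (\sum_(x in A) sin (2 * PI * (x * r)%:R / N%:R))).
Proof.
have arg (x : 'I_N) : (2 * PI * INR x * INR r / INR N)%R = 2 * PI * (x * r)%:R / N%:R :> R.
  rewrite !INRE natrM; change (2 * PI * x%:R * r%:R / N%:R = 2 * PI * (x%:R * r%:R) / N%:R :> R).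
  by ring.
rewrite /fourier_abs RsqrtE !RpowE /=; congr (Num.sqrt (_ ^+ 2 + _ ^+ 2)).
  by apply: eq_bigr => x _; rewrite arg.
by apply: eq_bigr => x _; rewrite arg.
Qed.

(** The reverse triangle inequality, with sqrt(2) <= 3/2. *)
Lemma dist_normc (u v : R[i]) (E : R) :
  `|complex.Re u - complex.Re v| <= E -> `|complex.Im u - complex.Im v| <= E ->
  `|Normc.normc u - Normc.normc v| <= 3 / 2 * E.
Proof.
move=> hre him; have E0 : 0 <= E by apply: le_trans hre.
have duv : Normc.normc (u - v) <= 3 / 2 * E.
  have E1 : 0 <= 3 / 2 * E by lra.
  rewrite -[3 / 2 * E](ger0_norm E1) -sqrtr_sqr.
  case: u v hre him => u1 u2 [v1 v2] /= hre him; apply: ler_wsqrtr.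
  have sq (t : R) : `|t| <= E -> t ^+ 2 <= E ^+ 2.
    by move=> h; rewrite -real_normK ?num_real // lerXn2r ?nnegrE.
  by have := sq _ hre; have := sq _ him; nra.
have h1 := le_normcD (u - v) v; have h2 := le_normcD (v - u) u.
have e1 : u - v + v = u by rewrite subrK.
have e2 : v - u + u = v by rewrite subrK.
have e3 : Normc.normc (v - u) = Normc.normc (u - v) by rewrite -normcN opprB.
have {}h1 : Normc.normc u <= Normc.normc (u - v) + Normc.normc v by rewrite -[in leLHS]e1.
have {}h2 : Normc.normc v <= Normc.normc (u - v) + Normc.normc u.
  by rewrite -[in leLHS]e2 -e3.
by rewrite ler_norml; apply/andP; split; lra.
Qed.

Lemma spectrum_realization (N p m : nat) (P : 'I_p -> {set 'I_N}) (delta alpha : R) :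
  (0 < N)%nat -> 0 < delta -> 0 < alpha -> 640 * Num.sqrt N%:R < alpha * N%:R ->
  alpha * 2 ^+ 27 <= delta -> delta * 2 ^+ p <= 1 ->
  (forall i, #|P i|%:R * alpha ^+ 2 * 2 ^+ 11 <= delta ^+ 2) ->
  (forall i j, i != j -> [disjoint P i & P j]) ->
  (forall c : 'I_N -> int, (forall i x, x \in P i -> (absz (c x) <= 2)%nat) ->
    \sum_(x in \bigcup_i P i) c x * x%:Z \in dvdz N ->
    forall i x, x \in P i -> c x = 0) ->
  (m <= N)%nat -> `|delta * N%:R - m%:R| <= 1 ->
  exists A : {set 'I_N}, #|A| = m /\ forall r : 'I_N,
    (alpha * N%:R <= fourier_abs A r) =
    [|| val r == 0%nat, r \in \bigcup_i P i | r \in negset (\bigcup_i P i)].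
Proof.
move=> N0 d0 al0 sqN ad dp sizeP disjP diss mN dm.
(* Chosen so that the modulus delta N a/4 on the spectrum equals 2 alpha N. *)
pose a := 8 * alpha / delta.
have a0 : 0 <= a by rewrite divr_ge0 ?mulr_ge0 ?ltW.
have NR : 0 < N%:R :> R by rewrite ltr0n.
have adelta : a * delta = 8 * alpha by rewrite /a divfK // gt_eqF.
have a_small : a <= 1 / 2 ^+ 24.
  have c24 : 0 < (2 : R) ^+ 24 by rewrite exprn_gt0.
  rewrite ler_pdivlMr // -(ler_pM2r d0) mulrAC adelta mul1r.
  have -> : 8 * alpha * 2 ^+ 24 = alpha * 2 ^+ 27 by ring.
  exact: ad.
(* By [sizeP], a^2 |P i| <= 64/2^11 <= 1, so the power is at most e <= 3. *)
have le4 i : (1 + a ^+ 2) ^+ #|P i| <= 4.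
  apply: (@le_trans _ _ (exp (a ^+ 2) ^+ #|P i|)).
    apply: lerXn2r; rewrite ?nnegrE ?exp_ge1Dx ?(ltW (exp_gt0 _)) //.
    by rewrite addr_ge0 ?sqr_ge0.
  rewrite expRX; apply: (@le_trans _ _ (exp 1)).
    apply: ler_exp; rewrite -mulr_natr -(ler_pM2r (exprn_gt0 2 d0)).
    have -> : a ^+ 2 * #|P i|%:R * delta ^+ 2 = #|P i|%:R * (a * delta) ^+ 2 by ring.
    rewrite adelta mul1r; apply: le_trans (sizeP i).
    have -> : #|P i|%:R * (8 * alpha) ^+ 2 = #|P i|%:R * alpha ^+ 2 * 64 by ring.
    by rewrite ler_wpM2l ?mulr_ge0 ?sqr_ge0 //; lra.
  apply: (@le_trans _ _ 3); last by rewrite ler_nat.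
  by have /RleP := exp_le_3.
have rz := riesz_bounds le4.
pose f x := delta * riesz a P x.
have f01 x : 0 <= f x <= 1.
  have /andP[r0 r1] := rz x; rewrite mulr_ge0 ?(ltW d0) //=.
  by apply: (@le_trans _ _ (delta * 2 ^+ p)); rewrite ?ler_pM2l.
(* One cosine and one sine row per frequency, 2N rows in all; the cosine row of frequency 0 is the
   constant row. *)
pose row (j : bool * 'I_N) (x : 'I_N) : R :=
  if j.1 then cos (2 * PI * (x * j.2)%:R / N%:R) else sin (2 * PI * (x * j.2)%:R / N%:R).
have row1 j x : `|row j x| <= 1.
  rewrite /row ler_norml; case: (j.1).
    by have [/RleP h1 /RleP h2] := COS_bound (2 * PI * (x * j.2)%:R / N%:R); apply/andP.
  by have [/RleP h1 /RleP h2] := SIN_bound (2 * PI * (x * j.2)%:R / N%:R); apply/andP.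
have hatN k := riesz_hat_nat a P N0 k.
have sumf : \sum_x f x = delta * N%:R.
  rewrite -mulr_sumr; congr (_ * _).
  have := hatN 0%nat; rewrite riesz_hat0 //.
  rewrite -[N%:R : R[i]](rmorph_nat (real_complex R)) => -[-> _].
  by apply: eq_bigr => x _; rewrite muln0 mulr0 mul0r cos_0 mulr1.
have [] := @round_with_card _ _ row row1 N f m (true, Ordinal N0).
- by rewrite card_prod card_bool card_ord.
- by rewrite card_ord.
- by move=> x; rewrite /row /= muln0 mulr0 mul0r cos_0.
- exact: f01.
- by rewrite card_ord.
- by rewrite sumf.
move=> A [cA Abound]; exists A; split=> // r.
set E := 2760 / 7 * Num.sqrt N%:R + 2051 in Abound.
have near : `|fourier_abs A r - delta * Normc.normc (riesz_hat a P r%:Z)| <= 3 / 2 * E.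
  have -> : delta * Normc.normc (riesz_hat a P r%:Z) =
      Normc.normc (Complex delta 0 * riesz_hat a P r%:Z).
    by rewrite Normc.normcM normc_real gtr0_norm.
  rewrite fourier_normc; apply: dist_normc; rewrite hatN /= !mul0r ?subr0 ?addr0 mulr_sumr.
    under [X in _ - X]eq_bigr do rewrite mulrA.
    exact: Abound (true, r).
  under [X in _ - X]eq_bigr do rewrite mulrA.
  exact: Abound (false, r).
have dl1 : delta <= 1.
  by apply: le_trans dp; rewrite ler_peMr ?(ltW d0) // exprn_ege1 // ler1n.
have al1 : alpha <= 1.
  by apply: le_trans dl1; apply: le_trans ad; rewrite ler_peMr ?(ltW al0) // exprn_ege1 // ler1n.
(* Since alpha <= 1, the hypothesis forces sqrt N > 640, so 2051 < 3.3 sqrt N and 3E/2 < 600 sqrt N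
   < (15/16) alpha N. *)
have Ele : 3 / 2 * E <= 15 / 16 * (alpha * N%:R).
  have s0 : 0 < Num.sqrt (N%:R : R) by rewrite sqrtr_gt0.
  have s640 : 640 < Num.sqrt (N%:R : R).
    rewrite -(ltr_pM2r s0); apply: lt_le_trans sqN _.
    by rewrite -expr2 sqr_sqrtr ?(ltW NR) // ler_piMl // ltW.
  by rewrite /E; move: sqN s640; move: (Num.sqrt _) => s; lra.
have {Ele near} /andP[lo hi] : - (15 / 16 * (alpha * N%:R)) <=
    fourier_abs A r - delta * Normc.normc (riesz_hat a P r%:Z) <= 15 / 16 * (alpha * N%:R).
  by rewrite -ler_norml; apply: le_trans Ele.
have aN0 : 0 < alpha * N%:R by rewrite mulr_gt0.
have large : 2 * (alpha * N%:R) <= delta * Normc.normc (riesz_hat a P r%:Z) ->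
  alpha * N%:R <= fourier_abs A r by move=> h; lra.
have single (n : R) : n = N%:R * (a / 4) -> 2 * (alpha * N%:R) <= delta * n.
  move=> ->; have -> : delta * (N%:R * (a / 4)) = a * delta * N%:R / 4 by ring.
  by rewrite adelta; lra.
have [r0|r0] := eqVneq (val r) 0%nat.
  rewrite /= large // [r%:Z](congr1 Posz r0) riesz_hat0 //.
  rewrite -[N%:R : R[i]](rmorph_nat (real_complex R)) normc_real normr_nat mulrA ler_pM2r //.
  by apply: le_trans ad; rewrite mulrC ler_pM2l // -[leLHS]expr1 ler_weXn2l ?ler1n.
have [rL|rL] := boolP (r \in \bigcup_i P i).
  case/bigcupP: rL => i _ rP; rewrite /= large //; apply: single.
  apply: (normc_riesz_hat_single N0 a0 disjP diss (t := Ordinal (isT : (0 < 3)%nat)) rP) => //.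
  by rewrite [coeff _]/(-1 : int) mulN1r addNr dvdz0.
have [rN|rN] /= := boolP (r \in negset _).
  rewrite large //; apply: single; case/imsetP: rN => l /bigcupP[i _ lP] rl.
  apply: (normc_riesz_hat_single N0 a0 disjP diss (t := Ordinal (isT : (2 < 3)%nat)) lP) => //.
  by rewrite [coeff _]/(1 : int) mul1r addrC negZN_dvd rl.
(* Elsewhere the transform of [f] is at most 2^-23 alpha N, which with the rounding error (15/16)
   alpha N stays below alpha N. *)
apply/negbTE; rewrite -ltNge.
have small : Normc.normc (riesz_hat a P r%:Z) <= N%:R * (a / 2) ^+ 2.
  apply: normc_riesz_hat_small => //.
  - by apply: (@le_trans _ _ (1 / 2 ^+ 24 / 2)); [rewrite ler_pM2r ?invr_gt0 | lra].
  - by change (~~ (N %| r)%nat); rewrite gtnNdvd // lt0n.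
  move=> i l lP; have lL : l \in \bigcup_i P i by apply/bigcupP; exists i.
  rewrite sub_ord_dvd negZN_dvd; apply/andP; split.
    by apply: contra rL => /eqP ->.
  by apply: contra rN => /eqP ->; apply: imset_f.
have : delta * Normc.normc (riesz_hat a P r%:Z) <= 2 * (alpha * N%:R) * (1 / 2 ^+ 24).
  apply: (@le_trans _ _ (delta * (N%:R * (a / 2) ^+ 2))); first by rewrite ler_pM2l.
  have -> : delta * (N%:R * (a / 2) ^+ 2) = a * delta * N%:R / 4 * a by field.
  rewrite adelta; have -> : 8 * alpha * N%:R / 4 = 2 * (alpha * N%:R) by field.
  by rewrite ler_wpM2l // mulr_ge0 // ltW.
by move: hi aN0; move: (Normc.normc _) (fourier_abs A r) (alpha * N%:R) => u v w; lra.
Qed.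

(** * Floors, logarithms, block sizes and disjointness *)

Lemma floorR_itv (x : R) : 0 <= x ->
  (Z.to_nat (floorR x))%:R <= x < (Z.to_nat (floorR x))%:R + 1.
Proof.
move=> x0; have [h1 h2] := base_Int_part x; rewrite -/(floorR x) in h1 h2.
have {}h1 : IZR (floorR x) <= x by apply/RleP.
have {}h2 : x < IZR (floorR x) + 1.
  have : -1 < IZR (floorR x) - x by apply/RltP.
  by lra.
have z0 : (0 <= floorR x)%Z.
  have : (-1 < floorR x)%Z by apply/lt_IZR/RltP; change (-1 < IZR (floorR x)); lra.
  by lia.
by rewrite -INRE INR_IZR_INZ Znat.Z2Nat.id // h1 h2.
Qed.

(** The second part, 2^p <= 1/delta for p = floor(log(1/delta)), is what keeps the function to be
    rounded at most 1. *)
Lemma log2_floor (delta : R) : 0 < delta -> delta <= 1 ->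
  0 <= log2 (1 / delta)%R /\ delta * 2 ^+ Z.to_nat (floorR (log2 (1 / delta)%R)) <= 1.
Proof.
move=> d0 d1.
have ln2 : 0 < ln 2%R.
  have : (ln 1 < ln 2)%R by apply: ln_increasing; apply/RltP; [exact: ltr01 | exact: ltr1n].
  by rewrite ln_1 => /RltP.
have d1' : 1 <= 1 / delta by rewrite ler_pdivlMr // mul1r.
have lnd : 0 <= ln (1 / delta)%R.
  move: d1'; rewrite le_eqVlt => /orP[/eqP e|/RltP lt].
    have -> : (1 / delta)%R = 1%R by exact: esym e.
    by rewrite ln_1.
  have /RltP : (ln 1 < ln (1 / delta))%R by apply: ln_increasing => //; apply/RltP/ltr01.
  by rewrite ln_1 => /ltW.
have lg0 : 0 <= log2 (1 / delta)%R.
  by change (0 <= ln (1 / delta)%R / ln 2%R); rewrite divr_ge0 // ltW.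
split=> //; have /andP[le _] := floorR_itv lg0; move: le; set p := Z.to_nat _ => le.
have e2 : exp (ln 2%R) = 2 by apply: exp_ln; apply/RltP; exact: (ltr0Sn _ 1).
have -> : (2 : R) ^+ p = exp (ln 2%R) ^+ p by rewrite e2.
rewrite expRX mulrC -ler_pdivlMr //.
have ed : exp (ln (1 / delta)%R) = 1 / delta.
  by apply: exp_ln; apply/RltP; exact: lt_le_trans ltr01 d1'.
rewrite -ed; apply: ler_exp.
have {}le : p%:R <= ln (1 / delta)%R / ln 2%R by exact: le.
by move: le; rewrite ler_pdivlMr // mulr_natl.
Qed.

(** Summing |P i| <= 2|P j| over j != i and adding 2|P i| gives the factor p + 1 rather than p. The
    gain matters because log(1/delta) is below p + 1 but may exceed p. *)
Lemma block_card_bound (T : finType) (p : nat) (P : 'I_p -> {set T}) (i : 'I_p) :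
  (forall i j, i != j -> [disjoint P i & P j]) ->
  (forall i j, (#|P i| <= 2 * #|P j|)%nat) ->
  (p.+1 * #|P i| <= 2 * #|\bigcup_i P i|)%nat.
Proof.
move=> disjP sizeP.
have -> : #|\bigcup_i P i| = (\sum_j #|P j|)%nat.
  rewrite -sum1_card partition_disjoint_bigcup //=.
  by apply: eq_bigr => j _; rewrite sum1_card.
rewrite (bigD1 i) //= mulnDr big_distrr /=.
apply: (@leq_trans (2 * #|P i| + \sum_(j < p | j != i) #|P i|)%nat).
  rewrite sum_nat_const cardC1 card_ord -mulnDl leq_mul2r; apply/orP; right.
  by have := ltn_ord i; lia.
by rewrite leq_add2l; apply: leq_sum => j _; exact: sizeP.
Qed.

(** If 0 were in the union, 1 * 0 = 0 would be a relation; if r = -l with both in it, r + l = 0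
    would be one. For r = l the coefficient is 2, still within the bound. *)
Lemma dissociated_disjoint (N p : nat) (hN : (0 < N)%nat) (P : 'I_p -> {set 'I_N}) :
  (forall c : 'I_N -> int, (forall i x, x \in P i -> (absz (c x) <= 2)%nat) ->
    \sum_(x in \bigcup_i P i) c x * x%:Z \in dvdz N ->
    forall i x, x \in P i -> c x = 0) ->
  [/\ [disjoint [set Ordinal hN] & \bigcup_i P i],
    [disjoint [set Ordinal hN] & negset (\bigcup_i P i)] &
    [disjoint \bigcup_i P i & negset (\bigcup_i P i)]].
Proof.
move=> diss; set L := \bigcup_i P i in diss *.
have sumI (r : 'I_N) : r \in L -> \sum_(x in L) (x == r)%:R * x%:Z = r%:Z.
  move=> rL; rewrite (bigD1 r) //= eqxx mul1r big1 ?addr0 // => x /andP[_ /negPf ->].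
  exact: mul0r.
have zeroL : Ordinal hN \notin L.
  apply/negP => zL; have /bigcupP[i _ zi] := zL.
  have : ((Ordinal hN == Ordinal hN)%:R : int) = 0.
    apply: (diss (fun x => (x == Ordinal hN)%:R) _ _ i _ zi) => [j x _|].
      by case: (x == _).
    by rewrite sumI // dvdz0.
  by rewrite eqxx.
have LnegL r l : r \in L -> l \in L -> r != negZN l.
  move=> rL lL; apply/negP; rewrite -negZN_dvd => dv.
  have /bigcupP[i _ ri] := rL.
  have : ((r == r)%:R + (r == l)%:R : int) = 0.
    apply: (diss (fun x => (x == r)%:R + (x == l)%:R) _ _ i _ ri) => [j x _|].
      by case: (x == r); case: (x == l).
    by under eq_bigr do rewrite mulrDl; rewrite big_split /= !sumI.
  by rewrite eqxx; case: (r == l).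
split; apply/pred0P => x /=; apply/negbTE/negP => /andP[].
- by rewrite inE => /eqP ->; rewrite (negPf zeroL).
- rewrite inE => /eqP -> /imsetP[l lL /eqP]; rewrite -negZN_dvd add0r.
  change ((N %| l)%nat -> False); case: (posnP l) => [l0 _|l0].
    have lz : l = Ordinal hN by apply: val_inj.
    by rewrite -lz lL in zeroL.
  by rewrite gtnNdvd.
- by move=> xL /imsetP[l lL /eqP]; rewrite (negPf (LnegL _ _ xL lL)).
Qed.

Close Scope ring_scope.
Bind Scope R_scope with R.

Theorem theorem13 (N : nat) (hN : (0 < N)%nat) (delta alpha : R) (L : {set 'I_N}) :
  (delta <= 1 / 8)%R ->
  (640 / sqrt (INR N) < alpha)%R ->
  (alpha <= delta / 2 ^ 27)%R ->
  in_Lambda_family ((delta / alpha) ^ 2)%R ((delta / alpha) ^ 2)%R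
    (Z.to_nat (floorR (log2 (1 / delta)))) L ->
  (INR #|L| <= (delta / alpha) ^ 2 * log2 (1 / delta) / 2 ^ 12)%R ->
  exists A : {set 'I_N},
    #|A| = Z.to_nat (floorR (delta * INR N)) /\
    large_spectrum alpha A = [set Ordinal hN] :|: L :|: negset L /\
    [disjoint [set Ordinal hN] & L] /\
    [disjoint [set Ordinal hN] & negset L] /\
    [disjoint L & negset L].
Proof.
Local Open Scope ring_scope.
move=> /RleP hd /RltP hN640 /RleP had [P [disjP [<- [sizeP diss]]]] /RleP hL.
have lit (k : positive) : IZR (Z.pos k) = (nat_of_pos k)%:R :> R by rewrite IZRposE INRE.
set q := log2 _ in P disjP sizeP diss hL *.
set p := Z.to_nat (floorR q) in P disjP sizeP diss hL *.
have NR : 0 < N%:R :> R by rewrite ltr0n.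
have s0 : 0 < Num.sqrt (N%:R : R) by rewrite sqrtr_gt0.
have {}hN640 : 640%:R < alpha * Num.sqrt N%:R.
  rewrite -ltr_pdivrMr //; move: hN640.
  by rewrite RsqrtE INRE (lit 640%positive) RdivE.
(* The lower bound on [alpha] makes it positive, and then [delta] is positive too. *)
have al0 : 0 < alpha.
  by rewrite -(pmulr_lgt0 _ s0); apply: lt_trans hN640; rewrite ltr0n.
have {}had : alpha * 2%:R ^+ 27 <= delta.
  by rewrite -ler_pdivlMr ?exprn_gt0 //; move: had; rewrite RpowE.
have d0 : 0 < delta.
  by apply: lt_le_trans had; rewrite mulr_gt0 // exprn_gt0.
have d1 : delta <= 1.
  apply: le_trans hd _; rewrite (lit 8%positive) RdivE ler_pdivrMr ?ltr0n //.
  by rewrite mul1r (ler_nat _ 1 8).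
have [q0 dp] := log2_floor d0 d1; rewrite -/q -/p in q0 dp.
have /andP[_ qp] := floorR_itv q0; rewrite -/p in qp.
have KE : ((delta / alpha) ^ 2)%R = (delta / alpha) ^+ 2 by exact: RpowE.
rewrite KE in diss hL.
have K0 : 0 < (delta / alpha) ^+ 2 by rewrite exprn_gt0 // divr_gt0.
(* With K = (delta/alpha)^2: (p + 1)|P i| <= 2|L| <= 2^-11 K log(1/delta) <= 2^-11 K (p + 1). *)
have sizeK i : #|P i|%:R * 2%:R ^+ 11 <= (delta / alpha) ^+ 2.
  have := block_card_bound i disjP sizeP; rewrite -(ler_nat R) !natrM -natr1 => hP.
  have {}hL : #|\bigcup_i P i|%:R * 2%:R ^+ 12 <= (delta / alpha) ^+ 2 * q.
    by rewrite -ler_pdivlMr ?exprn_gt0 //; move: hL; rewrite INRE RpowE.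
  have p0 : 0 < p%:R + 1 :> R by rewrite natr1 ltr0Sn.
  rewrite -(ler_pM2r p0).
  apply: (@le_trans _ _ ((delta / alpha) ^+ 2 * q)); last by rewrite ler_pM2l // ltW.
  apply: le_trans hL.
  have -> : 2%:R ^+ 12 = 2%:R * 2%:R ^+ 11 :> R by exact: exprS.
  have c11 : 0 <= 2%:R ^+ 11 :> R by exact: exprn_ge0.
  have := ler_wpM2r c11 hP; move: (2%:R ^+ 11) => c; lra.
have K2 : 2%:R <= (delta / alpha) ^+ 2.
  have h : 2%:R ^+ 27 <= delta / alpha by rewrite ler_pdivlMr // mulrC.
  have h2 : 2%:R <= delta / alpha.
    by apply: le_trans h; rewrite -[leLHS]expr1 ler_weXn2l ?ler1n.
  apply: (le_trans h2); rewrite -[leLHS]expr1 ler_weXn2l //.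
  by apply: (le_trans _ h2); rewrite ler1n.
(* Coefficients of size at most 2 meet both bounds of the family: 2 <= K, and their sum over a block
   is at most 2|P j| <= K by [sizeK]. *)
have diss' (c : 'I_N -> int) : (forall i x, x \in P i -> (absz (c x) <= 2)%nat) ->
    \sum_(x in \bigcup_i P i) c x * x%:Z \in dvdz N ->
    forall i x, x \in P i -> c x = 0.
  move=> c2 dv i x xP; apply: (diss c _ _ dv x); last by apply/bigcupP; exists i.
    move=> y /bigcupP[j _ yP]; apply/RleP; rewrite INRE; apply: le_trans K2.
    by rewrite ler_nat; exact: c2 yP.
  move=> j; apply/RleP; rewrite INRE; apply: le_trans (sizeK j).
  apply: (@le_trans _ _ (#|P j|%:R * 2%:R)).
    by rewrite -natrM ler_nat -sum_nat_const; apply: leq_sum => y; exact: c2.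
  by rewrite ler_wpM2l // -[leLHS]expr1 ler_weXn2l ?ler1n.
have dN0 : 0 <= delta * N%:R by rewrite mulr_ge0 ?(ltW d0) ?(ltW NR).
have /andP[m1 m2] := floorR_itv dN0.
have mE : Z.to_nat (floorR (delta * INR N)) = Z.to_nat (floorR (delta * N%:R)) by rewrite INRE.
have [||||A [cA spec]] := @spectrum_realization N p
  (Z.to_nat (floorR (delta * N%:R))) P delta alpha hN d0 al0 _ had dp _ disjP diss'.
- rewrite -{2}(sqr_sqrtr (ltW NR)) expr2 mulrA ltr_pM2r //.
- move=> i; have -> : delta ^+ 2 = (delta / alpha) ^+ 2 * alpha ^+ 2.
    by rewrite -exprMn divfK // gt_eqF.
  by rewrite mulrAC ler_pM2r ?exprn_gt0 //; exact: sizeK.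
- by rewrite -(ler_nat R); apply: le_trans m1 _; rewrite ler_piMl // ltW.
- by rewrite ler_norml; apply/andP; split; lra.
exists A; split; first by rewrite mE.
have [D1 D2 D3] := dissociated_disjoint hN diss'; split=> //.
apply/setP => r; rewrite inE [in RHS]inE [in RHS]inE inE -orbA.
have <- : (val r == 0%nat) = (r == Ordinal hN) by [].
rewrite -spec -INRE; case: Rle_dec => h; apply/esym.
  exact/RleP.
by apply/negbTE/negP => /RleP.
Qed.
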